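(* Let $\mathcal A=\{n_1,n_2,n_3\}$ be a set of three positive integers with $\gcd(n_1,n_2,n_3)=1$ such that the toric ideal $I_{\mathcal A}$ is a complete intersection. Then the Markov complexity $m(\mathcal A)$ of $\mathcal A$ is $2$. Moreover, for any $r\ge 2$ we have $\mathcal M(\mathcal A^{(r)})=\mathcal S(\mathcal A^{(r)})$, and the cardinality of $\mathcal M(\mathcal A^{(r)})$ is $k\binom r2$, where $k$ is the cardinality of the Graver basis of $\mathcal A$.
   Context: $\mathbb N$ contains $0$. For an integer matrix $D$ with $N$ columns and entries in $\mathbb N$ (or the configuration $\mathcal D$ of its columns), let $\mathcal L(\mathcal D)=\operatorname{Ker}_{\mathbb Z}(D)\subset\mathbb Z^N$. For $\mathbf u\in\mathbb Z^N$ write $\mathbf u=\mathbf u^+-\mathbf u^-$ with $\mathbf u^\pm\in\mathbb N^N$ of disjoint supports. The toric ideal $I_{\mathcal D}\subset\Bbbk[x_1,\dots,x_N]$ ($\Bbbk$ a field) is generated by all binomials $x^{\mathbf u}-x^{\mathbf w}$ with $\mathbf u,\mathbf w\in\mathbb N^N$, $\mathbf u-\mathbf w\in\mathcal L(\mathcal D)$. For $\mathcal A=\{n_1,n_2,n_3\}$ the matrix is $A=(n_1\ n_2\ n_3)$, and $I_{\mathcal A}$ is a complete intersection iff it can be generated by $2$ elements. A Markov basis of $\mathcal D$ is a finite subset $\mathcal M\subset\mathcal L(\mathcal D)$ such that for all $\mathbf w,\mathbf u\in\mathbb N^N$ with $\mathbf w-\mathbf u\in\mathcal L(\mathcal D)$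 there is a finite (possibly empty) sequence $\mathbf v_1,\dots,\mathbf v_s$ with $\mathbf v_i\in\mathcal M$ or $-\mathbf v_i\in\mathcal M$ such that $\mathbf w-\mathbf u=\sum_{i=1}^s\mathbf v_i$ and $\mathbf w-\sum_{i=1}^p\mathbf v_i\in\mathbb N^N$ for all $1\le p\le s$. It is minimal if no proper subset is a Markov basis. The universal Markov basis $\mathcal M(\mathcal D)$ is the union, and the indispensable subset $\mathcal S(\mathcal D)$ the intersection, of all minimal Markov bases of $\mathcal D$. The Graver basis $\mathcal G(\mathcal D)$ is the (finite) set of nonzero $\mathbf u\in\mathcal L(\mathcal D)$ that cannot be written $\mathbf u=\mathbf v+\mathbf w$ with $\mathbf v,\mathbf w\in\mathcal L(\mathcal D)$ nonzero, $\mathbf u^+=\mathbf v^++\mathbf w^+$ and $\mathbf u^-=\mathbf v^-+\mathbf w^-$. In $\mathcal M(\mathcal D)$, $\mathcal S(\mathcal D)$, $\mathcal G(\mathcal D)$, vectors differing only by a sign are identified, and cardinalities are counted with this identification. Lawrence lifting: for $A\in\mathcal M_{m\times n}(\mathbb N)$ and $r\ge 2$, $\mathcal A^{(r)}$ is the $(rm+n)\times rn$ matrix consisting of the block-diagonal matrix with $r$ diagonal blocks $A$, followed below by the row of blocks $(I_n\ I_n\ \cdots\ I_n)$. An element of $\mathcal L(\mathcal A^{(r)})$ is identified with an $r\times n$ integer matrix whose rows lie in $\mathcal L(\mathcal A)$ and sum to zero; its type is the number of its nonzero rows. The Markov complexity $m(\mathcal A)$ is the largest type of any vector in $\mathcal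 M(\mathcal A^{(r)})$ as $r\ge2$ varies. *)

(* Defs.v *)
From HB Require Import structures.
From mathcomp Require Import all_boot all_order all_algebra.
From mathcomp Require Import boolp classical_sets functions cardinality.
From mathcomp Require Import mpoly.

Set Implicit Arguments.
Unset Strict Implicit.
Unset Printing Implicit Defensive.

Import Order.TTheory GRing.Theory Num.Theory.

Local Open Scope classical_set_scope.
Local Open Scope ring_scope.

(* Integer vectors are columns over int; elements of N^N are the nonnegative
   ones. *)
Definition nonneg (N : nat) (v : 'cV[int]_N) : Prop :=
  forall i : 'I_N, 0 <= v i 0.

Definition pos_part (N : nat) (u : 'cV[int]_N) : 'cV[int]_N :=
  map_mx (Num.max 0) u.

Definition neg_part (N : nat) (u : 'cV[int]_N) : 'cV[int]_N :=
  pos_part (- u).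

Definition lattice (d N : nat) (D : 'M[nat]_(d, N)) : set 'cV[int]_N :=
  [set u | map_mx Posz D *m u = 0].

Definition ideal_gen (R : comNzRingType) (S : set R) : set R :=
  [set p | exists2 s : seq (R * R),
     (forall q, q \in s -> S q.2) & p = \sum_(q <- s) q.1 * q.2].

Definition toric_ideal (K : fieldType) (d N : nat) (D : 'M[nat]_(d, N)) :
    set {mpoly K[N]} :=
  ideal_gen [set p | exists u w : 'X_{1..N},
     lattice D (\col_(i < N) ((u i)%:Z - (w i)%:Z))
     /\ p = 'X_[u] - 'X_[w]].
Arguments toric_ideal K {d N} D.

(* For three positive integers the lattice has rank 3 - 1 = 2, so a complete
   intersection is generated by 2 elements. *)
Definition complete_intersection3 (K : fieldType) (A : 'rV[nat]_3) : Prop :=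
  exists f g : {mpoly K[3]}, toric_ideal K A = ideal_gen [set f; g].

Definition markov_basis (d N : nat) (D : 'M[nat]_(d, N))
    (M : set 'cV[int]_N) : Prop :=
  [/\ finite_set M, M `<=` lattice D &
    forall w u : 'cV[int]_N, nonneg w -> nonneg u -> lattice D (w - u) ->
      exists s : seq 'cV[int]_N,
        [/\ forall v, v \in s -> M v \/ M (- v),
            w - u = \sum_(v <- s) v &
            forall p : nat, (1 <= p <= size s)%N ->
              nonneg (w - \sum_(v <- take p s) v)]].

Definition minimal_markov_basis (d N : nat) (D : 'M[nat]_(d, N))
    (M : set 'cV[int]_N) : Prop :=
  markov_basis D M /\
  forall M' : set 'cV[int]_N, M' `<` M -> ~ markov_basis D M'.

(* Vectors differing only by a sign are identified by passing to the classes
   {u, -u}; the three bases below are sets of such classes. *)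
Definition sign_class (N : nat) (u : 'cV[int]_N) : set 'cV[int]_N :=
  [set u; - u].

Definition upto_sign (N : nat) (X : set 'cV[int]_N) : set (set 'cV[int]_N) :=
  @sign_class N @` X.

Definition universal_markov_basis (d N : nat) (D : 'M[nat]_(d, N)) :
    set (set 'cV[int]_N) :=
  \bigcup_(M in minimal_markov_basis D) upto_sign M.

Definition indispensable (d N : nat) (D : 'M[nat]_(d, N)) :
    set (set 'cV[int]_N) :=
  \bigcap_(M in minimal_markov_basis D) upto_sign M.

Definition graver_element (d N : nat) (D : 'M[nat]_(d, N)) :
    set 'cV[int]_N :=
  [set u | [/\ lattice D u, u != 0 &
    ~ exists v w : 'cV[int]_N,
        [/\ lattice D v /\ v != 0, lattice D w /\ w != 0, u = v + w,
            pos_part u = pos_part v + pos_part w &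
            neg_part u = neg_part v + neg_part w]]].

Definition graver_basis (d N : nat) (D : 'M[nat]_(d, N)) :
    set (set 'cV[int]_N) :=
  upto_sign (graver_element D).

(* The row and column counts r * m + n and r * n appear as the iterated sums
   required by block matrices. *)
Definition lawrence (r m n : nat) (A : 'M[nat]_(m, n)) :
    'M[nat]_(\sum_(i < r) m + n, \sum_(i < r) n) :=
  col_mx (\mxblock_(i < r, j < r) (if i == j then A else 0))
         (\mxrow_(j < r) (1%:M : 'M[nat]_n)).

(* The i-th row of the r x n matrix identified with u is the i-th block of u. *)
Definition vtype (r n : nat) (u : 'cV[int]_(\sum_(i < r) n)) : nat :=
  #|[pred i : 'I_r | submxcol u i != 0]|.

Definition is_markov_complexity (m n : nat) (A : 'M[nat]_(m, n)) (c : nat) :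
    Prop :=
  (forall (r : nat) (u : 'cV[int]_(\sum_(i < r) n)), (2 <= r)%N ->
     universal_markov_basis (lawrence r A) (sign_class u) -> (vtype u <= c)%N)
  /\
  (exists (r : nat) (u : 'cV[int]_(\sum_(i < r) n)),
     [/\ (2 <= r)%N, universal_markov_basis (lawrence r A) (sign_class u) &
         vtype u = c]).

Definition row3 (n1 n2 n3 : nat) : 'rV[nat]_3 :=
  \row_(j < 3) nth 0%N [:: n1; n2; n3] j.

(* Main.v *)
Require Import Defs.
From HB Require Import structures.
From mathcomp Require Import all_boot all_order all_algebra.
From mathcomp Require Import finmap boolp classical_sets functions cardinality.
From mathcomp Require Import mpoly zify ring.

(** Write [A] for the row [(n1, n2, n3)] and [L] for its lattice. An element of
the lattice of the Lawrence lifting is an [r x 3] matrix with rows in [L] and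
zero column sums. The claim is that the matrices with exactly two nonzero rows
[g], [- g], where [g] runs over the Graver basis of [A], form up to sign the
only minimal Markov basis. Counting them gives [k] times the number of pairs of
rows, and the type of each of them is 2.

These matrices are indispensable for every [A] whose lattice has no nonzero
nonnegative vector ([type2_graver_indispensable]): the fibre of the positive
part of such a matrix has only two points, because a third one would yield a
proper sign-compatible decomposition of [g]. A Markov basis made of
indispensable elements is the only minimal one up to sign
([universal_of_indispensable]), so it remains to connect the fibres by these
matrices.

A move that adds [v] to one row and [- v] to another one can be split along a
sign-compatible decomposition of [v] into Graver elements without leaving the
nonnegative orthant ([connected_type2]), so all moves with two nonzero rows may
be used. Fibres are then connected as soon as any two distinct points [w], [u]
of a fibre can be brought closer in the 1-norm by such a move, applied to [w]
or to [u]. Since only the rows of the difference [w - u] are known, the move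
applied to [w] must fit below the positive parts of two of these rows, and the
one applied to [u] below the negative parts; this is [distance_reducing].

For three integers this uses the complete intersection hypothesis. Let [c_i] be
the least positive integer such that [c_i n_i] is in the semigroup spanned by
the other two. The coefficient of [x_i ^ c_i] is a linear functional on the
toric ideal which vanishes on the products with the maximal ideal of the
origin. With two generators the three functionals are dependent, which forces
[c_i n_i = c_j n_j] for some [i != j]
([complete_intersection_equal_multiples]); otherwise the binomials [x_i ^ c_i -
x ^ u_i] form a dual basis. By Bezout and the minimality of [c_i], the third
integer times [gcd n_i n_j] is then in the semigroup spanned by [n_i] and [n_j]
([complete_intersection_glued]).

Up to order, [n1 = d m1], [n2 = d m2] with [m1], [m2] coprime and [n3 = m1 a +
m2 b + κ m1 m2] with [0 <= a < m2] and [0 <= b < m1], and [L] has the basis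
[(m2, - m1, 0)], [(a, b + κ m1, - d)]. Let [(p, q)] be the coordinates of a row
in this basis. For [q > 0] compare [p] with the interval from 0 to [κ q], and
for [q < 0] do the same with the opposite row. If some row is inside, a move
with second coordinate 1 fits between it and any row with [q] of the other sign
([reducible_rich]). If a row with [q > 0] and one with [q < 0] leave the
interval on the same side, they can be combined ([reduce_same_side]). In the
remaining case all [p] of the rows with [q != 0] have the same sign, and as the
[p] sum to zero there is a row with [q = 0] and [p] of the other sign, which
allows a move by [(m2, - m1, 0)] ([reducible_flat]). *)

Set Implicit Arguments.
Unset Strict Implicit.
Unset Printing Implicit Defensive.

Import Order.TTheory GRing.Theory Num.Theory.

Local Open Scope classical_set_scope.
Local Open Scope ring_scope.

(** * Lattices and integer vectors *)

Section Lattice.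
Variables (d N : nat) (D : 'M[nat]_(d, N)).

Lemma lattice0 : lattice D 0.
Proof. by rewrite /lattice /= mulmx0. Qed.

Lemma latticeN u : lattice D u -> lattice D (- u).
Proof. by rewrite /lattice /= mulmxN => ->; rewrite oppr0. Qed.

Lemma latticeD u v : lattice D u -> lattice D v -> lattice D (u + v).
Proof. by rewrite /lattice /= mulmxDr => -> ->; rewrite addr0. Qed.

Lemma latticeB u v : lattice D u -> lattice D v -> lattice D (u - v).
Proof. by move=> Lu /latticeN; apply: latticeD. Qed.

Lemma latticeNE u : lattice D (- u) <-> lattice D u.
Proof. by split=> /latticeN //; rewrite opprK. Qed.

End Lattice.

(** The entrywise conditions on a move that replaces the entries [d] and [d']
of two rows of a difference by [d - v] and [d' + v]. Nonnegative entries whose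
differences are [d] and [d'] are only known to be at least the positive parts
of [d] and [d'], so [fits] says that the positive part of [v] is at most that
of [d] and its negative part at most the positive part of [d']. *)
Definition fits (v d d' : int) : Prop :=
  (v <= 0 \/ v <= d) /\ (0 <= v \/ - v <= d').

(** The cases in which an entry of a fitting move makes [|d| + |d'|] strictly
smaller. *)
Definition drops (v d d' : int) : Prop :=
  (0 < v /\ d' < 0) \/ (v < 0 /\ d < 0).

(* Entries of matrices are generalised so that lia sees plain integers. *)
Ltac entrywise :=
  rewrite !mxE;
  repeat match goal with |- context [fun_of_matrix ?u ?c ?z] =>
    move: (fun_of_matrix u c z) => ? end;
  rewrite /fits /drops; lia.

Section Vectors.
Variable N : nat.
Implicit Types (u v w : 'cV[int]_N).

Lemma pos_partE u c : pos_part u c 0 = Num.max 0 (u c 0).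
Proof. by rewrite mxE. Qed.

Lemma nonneg_pos_part u : nonneg (pos_part u).
Proof. by move=> c; rewrite pos_partE le_max lexx. Qed.

Lemma pos_partB u : pos_part u - neg_part u = u.
Proof. by apply/colP=> c; entrywise. Qed.

(** The entries of [v] lie between 0 and those of [u], so that [u = v + (u -
v)] is a decomposition without cancellation. *)
Definition conformal v u : Prop :=
  forall c, 0 <= v c 0 <= u c 0 \/ u c 0 <= v c 0 <= 0.

Lemma conformalP v w :
  (pos_part (v + w) = pos_part v + pos_part w /\
   neg_part (v + w) = neg_part v + neg_part w) <-> conformal v (v + w).
Proof.
split=> [[/colP P /colP M] c|C].
  have := P c; have := M c; entrywise.
by split; apply/colP=> c; have := C c; entrywise.
Qed.

(** Moving from the positive part of [u] towards its negative part inside the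
orthant only meets vectors conformal to [u]. *)
Lemma conformal_pos_part u v :
  nonneg (pos_part u - v) -> nonneg (neg_part u + v) -> conformal v u.
Proof. by move=> P M c; have := P c; have := M c; entrywise. Qed.

Definition norm1 u : nat := (\sum_c `|u c 0%R|)%N.

Lemma norm1N u : norm1 (- u) = norm1 u.
Proof. by apply: eq_bigr => c _; rewrite !mxE abszN. Qed.

Lemma norm1_eq0 u : norm1 u = 0%N -> u = 0.
Proof.
move=> /eqP; rewrite sum_nat_eq0 => /forallP u0.
by apply/colP=> c; have /implyP/(_ isT) := u0 c; rewrite absz_eq0 mxE => /eqP.
Qed.

Lemma conformal_norm1 v w : conformal v (v + w) ->
  norm1 (v + w) = (norm1 v + norm1 w)%N.
Proof.
move=> C; rewrite /norm1 -big_split /=; apply: eq_bigr => c _.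
by have := C c; entrywise.
Qed.

Definition reduces v u w : Prop :=
  (forall c, fits (v c 0) (u c 0) (w c 0)) /\
  exists c, drops (v c 0) (u c 0) (w c 0).

(** Where [v] is positive, the fitting condition makes the first row lose
exactly what the second may gain, and conversely where [v] is negative; hence
the sum of the norms cannot grow, and it drops at a strict entry. *)
Lemma reduces_norm1 v u w : reduces v u w ->
  (norm1 (u - v) + norm1 (w + v) < norm1 u + norm1 w)%N.
Proof.
move=> [F [c0 dr]]; rewrite /norm1 -!big_split /=.
rewrite (bigD1 c0) //= [X in (_ < X)%N](bigD1 c0) //= -addSn.
apply: leq_add.
  by have := F c0; move: dr; entrywise.
by apply: leq_sum => c _; have := F c; entrywise.
Qed.

End Vectors.

(** * Paths of moves *)

Section Connected.
Variables (N : nat) (M : set 'cV[int]_N).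

(** The sequences of moves in the definition of a Markov basis, as an inductive
relation: this form can be concatenated and reversed. *)
Inductive connected : 'cV[int]_N -> 'cV[int]_N -> Prop :=
| connected_refl w : connected w w
| connected_step w v u : M v \/ M (- v) -> nonneg (w - v) ->
    connected (w - v) u -> connected w u.

Lemma connected_trans u v w : connected u v -> connected v w -> connected u w.
Proof.
elim=> // {u v} u x v Mx nn _ IH vw.
by apply: (connected_step Mx nn); apply: IH.
Qed.

Lemma connected_sym w u : nonneg w -> connected w u -> connected u w.
Proof.
move=> nw wu; elim: wu nw => {w u} [w _|w v u Mv nn _ IH nw];
  first exact: connected_refl.
apply: connected_trans (IH nn) _.
apply: (@connected_step _ (- v)); rewrite ?opprK ?subrK //; first by case: Mv;
  [right|left].
exact: connected_refl.
Qed.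

Lemma connectedP w u : connected w u <->
  exists s : seq 'cV[int]_N,
    [/\ forall v, v \in s -> M v \/ M (- v),
        w - u = \sum_(v <- s) v &
        forall p : nat, (1 <= p <= size s)%N ->
          nonneg (w - \sum_(v <- take p s) v)].
Proof.
split.
  elim=> {w u} [w|w v u Mv nn _ [s [Ms sum_s path_s]]].
    by exists [::]; split=> // [|[]//]; rewrite big_nil subrr.
  exists (v :: s); split=> [x||[//|[|p]] /= le_p].
  - by rewrite inE => /orP[/eqP->|/Ms].
  - by rewrite big_cons -sum_s; apply/colP=> c; rewrite !mxE; ring.
  - by rewrite take0 big_seq1.
  - by rewrite big_cons opprD addrA; apply: path_s.
case=> s; elim: s w => [|v s IH] w [Ms sum_s path_s].
  by move: sum_s; rewrite big_nil => /subr0_eq ->; exact: connected_refl.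
apply: (@connected_step w v); first by apply: Ms; rewrite mem_head.
  by have := path_s 1%N isT; rewrite /= take0 big_seq1.
apply: IH; split=> [x xs||p /andP[p0 ps]].
- by apply: Ms; rewrite inE xs orbT.
- by rewrite big_cons in sum_s; rewrite addrAC sum_s addrAC subrr add0r.
have := path_s p.+1; rewrite /= big_cons opprD addrA; apply.
by rewrite ltnS.
Qed.

End Connected.

(** In a fibre with the two points [w] and [u], the first nonzero move of a
path from [w] to [u] has to be [w - u]. *)
Lemma connected_two_point N (M : set 'cV[int]_N) w u :
  (forall v, nonneg (w - v) -> M v \/ M (- v) -> v = 0 \/ v = w - u) ->
  w != u -> connected M w u -> M (w - u) \/ M (- (w - u)).
Proof.
move=> fib ne wu; elim: wu fib ne => {w u} [w|w v u Mv nn _ IH] fib ne.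
  by rewrite eqxx in ne.
case: (fib v nn Mv) => [v0|<-//]; rewrite v0 subr0 in IH.
exact: IH.
Qed.

(** * The Graver basis *)

Section Graver.
Variables (d N : nat) (D : 'M[nat]_(d, N)).

Lemma conformalN (v u : 'cV[int]_N) : conformal v u -> conformal (- v) (- u).
Proof. by move=> C c; have := C c; entrywise. Qed.

Lemma graver_elementP u : graver_element D u <->
  [/\ lattice D u, u != 0 &
      forall v, lattice D v -> conformal v u -> v = 0 \/ v = u].
Proof.
split=> [[Lu u0 G]|[Lu u0 G]]; split=> //.
- move=> v Lv C; apply: contrapT => /not_orP[/eqP v0 /eqP vu].
  have e : u = v + (u - v) by rewrite addrC subrK.
  apply: G; exists v, (u - v); rewrite e in C;
    have [P M] := (conformalP _ _).2 C.
  rewrite -e in P M; split=> //; split=> //; first exact: latticeB.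
  by rewrite subr_eq0 eq_sym.
- case=> v [w [[Lv v0] [Lw w0] e P M]]; rewrite e in P M.
  have C : conformal v u by rewrite e; apply/conformalP.
  case: (G v Lv C) => h; first by rewrite h eqxx in v0.
  by move: w0; rewrite -(addKr v w) -e h addNr eqxx.
Qed.

Lemma graver_elementN u : graver_element D u -> graver_element D (- u).
Proof.
move=> /graver_elementP[Lu u0 G]; apply/graver_elementP; split.
- exact: latticeN.
- by rewrite oppr_eq0.
move=> v Lv C; have [||e|e] := G (- v).
- exact: latticeN.
- by rewrite -[u]opprK; apply: conformalN.
- by left; rewrite -[v]opprK e oppr0.
by right; rewrite -e opprK.
Qed.

(** Every lattice vector is a sum without cancellation of Graver elements: a
vector that is not one splits into two conformal parts of smaller norm. *)
Lemma lattice_conformal_ind (P : 'cV[int]_N -> Prop) :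
  P 0 -> (forall g, graver_element D g -> P g) ->
  (forall v w, lattice D v -> lattice D w -> conformal v (v + w) ->
     P v -> P w -> P (v + w)) ->
  forall u, lattice D u -> P u.
Proof.
move=> P0 PG PD u; move: {2}(norm1 u).+1 (ltnSn (norm1 u)) => k.
elim: k u => // k IH u le_u Lu.
have [->//|u0] := eqVneq u 0.
have [/PG//|notG] := pselect (graver_element D u).
have [v [Lv C v0 vu]] : exists v,
    [/\ lattice D v, conformal v u, v != 0 & v != u].
  apply: contrapT => none; apply: notG; apply/graver_elementP;
    split=> // v Lv C.
  apply: contrapT => /not_orP[/eqP v0 /eqP vu]; apply: none; by exists v.
have e : u = v + (u - v) by rewrite addrC subrK.
have Lw := latticeB Lu Lv.
move: le_u C; rewrite e => le_u C; have nm := conformal_norm1 C;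
  rewrite nm in le_u.
have v1 : (0 < norm1 v)%N by rewrite lt0n; apply: contra_neq v0;
  apply: norm1_eq0.
have w1 : (0 < norm1 (u - v))%N.
  by rewrite lt0n; apply: contra_neq vu => /norm1_eq0/subr0_eq.
by apply: PD => //; apply: IH => //; lia.
Qed.

Lemma graver_exists u : lattice D u -> u != 0 -> exists g, graver_element D g.
Proof.
move=> Lu; move: u Lu; apply: lattice_conformal_ind
  => [|g Gg _|v w _ _ _ IHv IHw vw].
- by rewrite eqxx.
- by exists g.
have [v0|/IHv//] := eqVneq v 0; apply: IHw.
by rewrite v0 add0r in vw.
Qed.

End Graver.

(** * Indispensable moves and the universal Markov basis *)

Section SignClasses.
Variable N : nat.
Implicit Types (u v : 'cV[int]_N) (X : set 'cV[int]_N).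

Lemma sign_classN u : sign_class (- u) = sign_class u.
Proof. by rewrite /sign_class opprK setUC. Qed.

Lemma sign_class_eq u v : sign_class u = sign_class v -> u = v \/ u = - v.
Proof.
by move=> e; have : sign_class u u by [left]; rewrite e => -[]; [left|right].
Qed.

Lemma upto_signP X u : upto_sign X (sign_class u) <-> X u \/ X (- u).
Proof.
split=> [[v Xv e]|[Xu|Xu]].
- by case: (sign_class_eq e) Xv => ->; [left|right].
- by exists u.
by exists (- u); rewrite ?sign_classN.
Qed.

Lemma sub_upto_sign X (Y : set 'cV[int]_N) :
  (forall u, X u -> Y u \/ Y (- u)) -> upto_sign X `<=` upto_sign Y.
Proof. by move=> XY _ [u Xu <-]; apply/upto_signP/XY. Qed.

(** One vector per sign class; a minimal Markov basis cannot contain both [u]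
and [- u]. *)
Definition sign_rep u : 'cV[int]_N := xget 0 (sign_class u).

Lemma sign_repP u : sign_rep u = u \/ sign_rep u = - u.
Proof.
have : sign_class u (sign_rep u) by apply: xgetPex; exists u; left.
by case; [left|right].
Qed.

Lemma sign_repN u : sign_rep (- u) = sign_rep u.
Proof. by rewrite /sign_rep sign_classN. Qed.

End SignClasses.

Lemma markov_basis_connected d N (D : 'M[nat]_(d, N)) (M : set 'cV[int]_N) :
  markov_basis D M <->
  [/\ finite_set M, M `<=` lattice D &
    forall w u, nonneg w -> nonneg u -> lattice D (w - u) -> connected M w u].
Proof.
split=> -[fM ML path_M]; split=> // w u nw nu Lwu.
  by apply/connectedP; apply: path_M.
by apply/connectedP; apply: path_M.
Qed.

Lemma connected_sub N (M M' : set 'cV[int]_N) w u :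
  (forall v, M v -> M' v \/ M' (- v)) -> connected M w u -> connected M' w u.
Proof.
move=> MM'; elim=> {w u} [w|w v u Mv nn _ IH]; first exact: connected_refl.
apply: connected_step nn IH; case: Mv => /MM'; rewrite ?opprK; tauto.
Qed.

(** Each minimal Markov basis [M] meets every sign class of [T], and its
elements outside these classes can be removed since the others already connect
what [T] connects. Hence all minimal Markov bases have the sign classes of [T],
and one exists because a set of representatives of these classes cannot be
shrunk. *)
Lemma universal_of_indispensable d N (D : 'M[nat]_(d, N)) (T : set 'cV[int]_N) :
  markov_basis D T ->
  (forall M u, markov_basis D M -> T u -> M u \/ M (- u)) ->
  universal_markov_basis D = upto_sign T /\ indispensable D = upto_sign T.
Proof.
move=> TM ind.
have minM M : minimal_markov_basis D M -> upto_sign M = upto_sign T.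
  move=> [MM minM]; apply/seteqP; split; last first.
    by apply: sub_upto_sign => u Tu; apply: ind.
  apply: sub_upto_sign => u Mu; apply: contrapT => notTu.
  pose M' := [set v | M v /\ (T v \/ T (- v))].
  apply: (minM M').
    by split=> [v []//|e]; apply: notTu; have [] := e u Mu.
  have [fM ML _] := (markov_basis_connected _ _).1 MM.
  have [_ _ Tc] := (markov_basis_connected _ _).1 TM.
  apply/markov_basis_connected; split=> [|v []/ML//|w z nw nz Lwz].
    by apply: sub_finite_set fM => v [].
  apply: connected_sub (Tc w z nw nz Lwz) => v Tv; rewrite /M' /= opprK.
  by case: (ind M v MM Tv) => ?; [left|right]; split=> //; [left|right].
have [M0 M0min] : exists M, minimal_markov_basis D M.
  have [fT TL Tc] := (markov_basis_connected _ _).1 TM.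
  exists (@sign_rep N @` T); split.
    apply/markov_basis_connected; split=> [|_ [v /TL Lv <-]|w u nw nu Lwu].
    - exact: finite_image.
    - by case: (sign_repP v) => ->; first [exact: Lv|exact: latticeN].
    apply: connected_sub (Tc w u nw nu Lwu) => v Tv.
    case: (sign_repP v) => e; [left|right]; exists v => //.
  move=> M' [sub nsub] M'M; apply: nsub => _ [v Tv <-].
  have rep_id u : M' u -> sign_rep u = u.
    move=> /sub[x _ <-]; by case: (sign_repP x) => e; rewrite {1}e ?sign_repN.
  case: (ind M' v M'M Tv) => M'v; first by rewrite rep_id.
  by rewrite -sign_repN rep_id.
split; apply/seteqP.
  by split=> [C [M Mmin]|C TC]; [rewrite minM|exists M0; rewrite ?minM].
by split=> [C /(_ M0 M0min)|C TC M Mmin]; rewrite minM.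
Qed.

(** * Lawrence liftings *)

Section Blocks.
Variables (r n : nat).
Implicit Types (u w : 'cV[int]_(\sum_(i < r) n)) (v : 'cV[int]_n).

Lemma nonneg_blocks w : nonneg w <-> forall k, nonneg (submxcol w k).
Proof.
split=> [nw k c|nw s]; first by rewrite mxE; apply: nw.
by have := nw (tagnat.sig1 s) (tagnat.sig2 s); rewrite mxE tagnat.sig2K.
Qed.

(** As the rows of an element of the lattice of a Lawrence lifting sum to zero,
every element of type 2 has this form. *)
Definition type2 (i j : 'I_r) v : 'cV[int]_(\sum_(k < r) n) :=
  \mxcol_(k < r) (if k == i then v else if k == j then - v else 0).

Lemma submxcol_type2 i j v k :
  submxcol (type2 i j v) k = if k == i then v else if k == j then - v else 0.
Proof. by rewrite mxcolK. Qed.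

Lemma type2_i i j v : submxcol (type2 i j v) i = v.
Proof. by rewrite submxcol_type2 eqxx. Qed.

Lemma type2_j i j v : i != j -> submxcol (type2 i j v) j = - v.
Proof. by move=> ij; rewrite submxcol_type2 eq_sym (negPf ij) eqxx. Qed.

Lemma type2_k i j v k : k != i -> k != j -> submxcol (type2 i j v) k = 0.
Proof. by move=> /negPf ki /negPf kj; rewrite submxcol_type2 ki kj. Qed.

Lemma type2D i j v v' : type2 i j (v + v') = type2 i j v + type2 i j v'.
Proof.
apply/mxcolP=> k; rewrite submxcolD !submxcol_type2.
by case: eqP => // _; case: eqP => // _; rewrite ?opprD ?addr0.
Qed.

Lemma type20 i j : type2 i j 0 = 0.
Proof.
by apply/mxcolP=> k; rewrite submxcol_type2 submxcol0 oppr0; case: eqP => // _;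
  case: eqP.
Qed.

Lemma type2N i j v : type2 i j (- v) = - type2 i j v.
Proof. by apply/eqP; rewrite -subr_eq0 opprK -type2D addNr type20. Qed.

Lemma type2_swap i j v : i != j -> type2 j i v = type2 i j (- v).
Proof.
move=> ij; apply/mxcolP=> k; rewrite !submxcol_type2.
case: (eqVneq k j) => [->|_]; first by rewrite eq_sym (negPf ij) opprK.
by case: eqP.
Qed.

Lemma type2_inj i j : injective (type2 i j).
Proof. by move=> v v' /mxcolP/(_ i); rewrite !type2_i. Qed.

Lemma sum_two_blocks i j w : i != j -> \sum_k submxcol w k = 0 ->
  (forall k, k != i -> k != j -> submxcol w k = 0) ->
  w = type2 i j (submxcol w i).
Proof.
move=> ij; rewrite (bigD1 i) //= (bigD1 j) 1?eq_sym //= => s0 w0.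
rewrite big1 ?addr0 in s0; last by move=> k /andP[]; apply: w0.
apply/mxcolP=> k; rewrite submxcol_type2.
case: (eqVneq k i) => [->//|ki]; case: (eqVneq k j) => [->|kj]; last exact: w0.
by apply/eqP; rewrite -addr_eq0 addrC s0.
Qed.

Lemma vtype_type2 i j v : i != j -> v != 0 -> vtype (type2 i j v) = 2%N.
Proof.
move=> ij v0; have -> : 2%N = #|[set i; j]%SET| by rewrite cards2 ij.
apply: eq_card => k.
rewrite !inE submxcol_type2; case: (eqVneq k i) => [_|ki]; first by rewrite v0.
by case: (eqVneq k j) => [_|kj]; rewrite ?oppr_eq0 ?eqxx.
Qed.

Definition block_norm w : nat := (\sum_k norm1 (submxcol w k))%N.

Lemma block_norm_type2 i j v w : i != j ->
  reduces v (submxcol w i) (submxcol w j) ->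
  (block_norm (w - type2 i j v) < block_norm w)%N.
Proof.
move=> ij /reduces_norm1 lt_ij; rewrite /block_norm.
rewrite (bigD1 i) // (bigD1 j) 1?eq_sym //=.
rewrite [X in (_ < X)%N](bigD1 i) // (bigD1 j) 1?eq_sym //=.
rewrite !submxcolB type2_i type2_j // opprK !addnA -addSn.
apply: leq_add => //; apply: leq_sum => k /andP[ki kj].
by rewrite submxcolB type2_k ?subr0.
Qed.

Lemma block_normN w : block_norm (- w) = block_norm w.
Proof. by apply: eq_bigr => k _; rewrite submxcolN norm1N. Qed.

End Blocks.

Lemma lattice_lawrence r m n (A : 'M[nat]_(m, n))
    (u : 'cV[int]_(\sum_(i < r) n)) :
  lattice (lawrence r A) u <->
  (forall k, lattice A (submxcol u k)) /\ \sum_k submxcol u k = 0.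
Proof.
rewrite /lattice /lawrence /= map_col_mx mul_col_mx.
have -> : map_mx Posz (\mxblock_(i < r, j < r) (if i == j then A else 0)) =
    \mxblock_(i < r, j < r) (if i == j then map_mx Posz A else 0).
  apply/matrixP=> s t; rewrite !mxE; case: eqP => _; by rewrite !mxE.
have -> : map_mx Posz (\mxrow_(j < r) (1%:M : 'M[nat]_n)) = \mxrow_(j < r) 1%:M.
  apply/matrixP=> s t; rewrite !mxE; by case: eqP.
rewrite -{1 2}[u]submxcolK mul_mxblock_mxrow mul_mxrow_mxcol.
have -> : (\mxcol_i \sum_j
      (if i == j then map_mx Posz A else 0) *m submxcol u j) =
    \mxcol_i (map_mx Posz A *m submxcol u i).
  apply/mxcolP=> k; rewrite !mxcolK (bigD1 k) //= eqxx big1 ?addr0 // => j.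
  by rewrite eq_sym => /negPf ->; rewrite mul0mx.
under [X in col_mx _ X]eq_bigr do rewrite mul1mx.
split=> [/eqP|[/= Lu s0]].
  rewrite col_mx_eq0 => /andP[/eqP/mxcolP Lu /eqP s0]; split=> // k.
  by have := Lu k; rewrite mxcolK submxcol0.
apply/eqP; rewrite col_mx_eq0 s0 eqxx andbT; apply/eqP/mxcolP => k.
by rewrite mxcolK submxcol0.
Qed.

Lemma lattice_type2 r m n (A : 'M[nat]_(m, n)) i j v :
  i != j -> lattice A v -> lattice (lawrence r A) (type2 i j v).
Proof.
move=> ij Lv; apply/lattice_lawrence; split=> [k|].
  rewrite submxcol_type2; case: eqP => // _; case: eqP => _;
    first exact: latticeN.
  exact: lattice0.
rewrite (bigD1 i) // (bigD1 j) 1?eq_sym //= type2_i type2_j // big1 ?addr0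
  ?subrr //.
by move=> k /andP[]; apply: type2_k.
Qed.

Definition type2_graver r m n (A : 'M[nat]_(m, n)) :
    set 'cV[int]_(\sum_(i < r) n) :=
  [set u | exists i j g, [/\ i != j, graver_element A g & u = type2 i j g]].

Definition pointed m n (A : 'M[nat]_(m, n)) : Prop :=
  forall v, lattice A v -> nonneg v -> v = 0.

(** The matrices [D] are the differences of two points [w], [u] of a fibre; the
two alternatives are a move applied to [w] and one applied to [u]. *)
Definition distance_reducing m n (A : 'M[nat]_(m, n)) : Prop :=
  forall (r : nat) (D : 'I_r -> 'cV[int]_n),
    (forall k, lattice A (D k)) -> \sum_k D k = 0 -> (exists k, D k != 0) ->
    exists i j v, [/\ i != j, lattice A v &
      reduces v (D i) (D j) \/ reduces (- v) (- D i) (- D j)].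

Section Lawrence.
Variables (m n : nat) (A : 'M[nat]_(m, n)).

Section FixedR.
Variable (r : nat).
Local Notation L := (lattice (lawrence r A)).
Local Notation T := (@type2_graver r m n A).

Lemma type2_graver_lattice : T `<=` L.
Proof. by move=> _ [i [j [g [ij [Lg _ _] ->]]]]; apply: lattice_type2. Qed.

(** If [pos_part u - v] is in the fibre of [pos_part u], then its rows other
than [i] and [j] have degree 0, hence vanish since [A] is pointed. So [v] is
the move by some vector between rows [i] and [j], and nonnegativity makes this
vector conformal to the Graver element [g]: it is 0 or [g]. *)
Lemma type2_graver_indispensable (M : set 'cV[int]_(\sum_(i < r) n)) u :
  pointed A -> markov_basis (lawrence r A) M -> T u -> M u \/ M (- u).
Proof.
move=> ptA [_ ML path_M] [i [j [g [ij /graver_elementP[Lg g0 G] e]]]].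
rewrite -(pos_partB u).
have Lu : L (pos_part u - neg_part u).
  by rewrite pos_partB e; apply: lattice_type2.
have u0 : u != 0.
  by rewrite e -(type20 _ i j); apply: contra_neq g0; apply: type2_inj.
have/connectedP := path_M _ _ (nonneg_pos_part u) (nonneg_pos_part (- u)) Lu.
apply: connected_two_point => [v nn Mv|]; last by rewrite -subr_eq0 pos_partB.
rewrite pos_partB.
have [Lv sv] : (forall k, lattice A (submxcol v k)) /\ \sum_k submxcol v k = 0.
  apply/lattice_lawrence; case: Mv => /ML; [by []|by move/latticeNE].
have blk k c : (pos_part u - v) (tagnat.Rank k c) 0 =
    Num.max 0 (submxcol u k c 0) - submxcol v k c 0.
  by rewrite !mxE.
have v0 k : k != i -> k != j -> submxcol v k = 0.
  move=> ki kj; rewrite -[submxcol v k]opprK.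
  rewrite (ptA _ (latticeN (Lv k))) ?oppr0 // => c.
  have := nn (tagnat.Rank k c); rewrite blk e type2_k //; entrywise.
have ev := sum_two_blocks ij sv v0.
have vj : submxcol v j = - submxcol v i by rewrite [in LHS]ev type2_j.
have [||t0|tg] := G (submxcol v i).
- exact: Lv.
- apply: conformal_pos_part => c.
    have := nn (tagnat.Rank i c); rewrite blk e type2_i; entrywise.
  have := nn (tagnat.Rank j c); rewrite blk vj e type2_j //; entrywise.
- by left; rewrite ev t0 type20.
by right; rewrite ev tg.
Qed.

(** Along a sign-compatible decomposition of [v] the intermediate points lie
entrywise between the two ends, hence stay nonnegative; so a move by [v] may be
replaced by moves by Graver elements. *)
Lemma connected_type2 i j v w : i != j -> lattice A v ->
  nonneg w -> nonneg (w - type2 i j v) -> connected T w (w - type2 i j v).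
Proof.
move=> ij Lv; move: v Lv w; apply: lattice_conformal_ind
  => [|g Gg|v v' Lv Lv' C IH IH'] w nw nwv.
- by rewrite type20 subr0; apply: connected_refl.
- apply: connected_step (connected_refl _ _) => //.
  by left; exists i, j, g.
have nmid : nonneg (w - type2 i j v).
  apply/nonneg_blocks => k c; move/nonneg_blocks/(_ k c): nw.
  move/nonneg_blocks/(_ k c): nwv; rewrite !submxcolB !submxcol_type2.
  case: eqP => _; last case: eqP => _; last by entrywise.
    have := C c; entrywise.
  have := C c; entrywise.
rewrite type2D opprD addrA in nwv *.
exact: connected_trans (IH _ nw nmid) (IH' _ nmid nwv).
Qed.

Lemma reduces_step i j v w u : i != j -> lattice A v -> nonneg w -> nonneg u ->
  L (w - u) -> reduces v (submxcol (w - u) i) (submxcol (w - u) j) ->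
  exists w', [/\ nonneg w', L (w' - u), connected T w w' &
                 (block_norm (w' - u) < block_norm (w - u))%N].
Proof.
move=> ij Lv nw nu Lwu red; exists (w - type2 i j v).
have e : w - type2 i j v - u = w - u - type2 i j v by rewrite addrAC.
have nw' : nonneg (w - type2 i j v).
  case: red => F _; apply/nonneg_blocks => k c; move/nonneg_blocks/(_ k c): nw.
  move/nonneg_blocks/(_ k c): nu.
  rewrite submxcolB submxcol_type2; case: eqP => [->|_].
    have := F c; rewrite submxcolB; entrywise.
  case: eqP => [->|_]; last by entrywise.
  have := F c; rewrite submxcolB; entrywise.
split=> //; rewrite ?e.
- by apply: latticeB => //; apply: lattice_type2.
- exact: connected_type2.
exact: block_norm_type2.
Qed.

Lemma type2_graver_connected w u : distance_reducing A ->
  nonneg w -> nonneg u -> L (w - u) -> connected T w u.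
Proof.
move=> redA; move: {2}(block_norm (w - u)).+1 (ltnSn (block_norm (w - u))) => b.
elim: b w u => // b IH w u le_b nw nu Lwu.
have [->|wu] := eqVneq w u; first exact: connected_refl.
have [LD sD] := (lattice_lawrence _ _).1 Lwu.
have [||i [j [v [ij Lv red]]]] := redA r (submxcol (w - u)) LD.
- exact: sD.
- apply: contrapT => none; move: wu; rewrite -subr_eq0 => /eqP; apply.
  apply/mxcolP=> k; rewrite submxcol0; apply: contrapT => /eqP Dk.
  by apply: none; exists k.
case: red => red.
  have [w' [nw' Lw' ww' lt_b]] := reduces_step ij Lv nw nu Lwu red.
  by apply: connected_trans ww' _; apply: IH => //; lia.
rewrite -!submxcolN opprB in red; rewrite -[w - u]opprB block_normN in le_b.
have Luw : L (u - w) by rewrite -opprB; apply: latticeN.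
have [u' [nu' Lu' uu' lt_b]] := reduces_step ij (latticeN Lv) nu nw Luw red.
apply: connected_trans _ (connected_sym nu uu').
by apply: (connected_sym nu'); apply: IH => //; exact: leq_trans lt_b le_b.
Qed.

Lemma type2_graver_finite : finite_set (graver_element A) -> finite_set T.
Proof.
move=> fG; apply: (@sub_finite_set _ _
  ((fun x : 'I_r * 'I_r * 'cV[int]_n => type2 x.1.1 x.1.2 x.2) @`
     ([set: 'I_r * 'I_r] `*` graver_element A))).
  by move=> _ [i [j [g [_ Gg ->]]]]; exists (i, j, g).
by apply/finite_image/finite_setX => //; apply: finite_finset.
Qed.

Lemma type2_graver_markov : distance_reducing A ->
  finite_set (graver_element A) -> markov_basis (lawrence r A) T.
Proof.
move=> redA fG; apply/markov_basis_connected; split.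
- exact: type2_graver_finite.
- exact: type2_graver_lattice.
by move=> w u; apply: type2_graver_connected.
Qed.

End FixedR.
End Lawrence.

(** * The universal Markov basis of a Lawrence lifting *)

Lemma card_setT_fin (T : finType) : ([set: T] #= `I_#|T|)%card.
Proof.
have -> : [set: T] = enum_val @` [set: 'I_#|T|].
  by apply/seteqP; split=> // x _; exists (enum_rank x); rewrite ?enum_rankK.
apply: card_eq_trans (inj_card_eq _) (card_esym card_II).
by move=> x y _ _; apply: enum_val_inj.
Qed.

Lemma card_ordered_pairs r :
  #|{: {x : 'I_r * 'I_r | (x.1 < x.2)%N}}| = 'C(r, 2).
Proof.
rewrite card_sig -sum1_card
  -(pair_big_dep xpredT (fun i j : 'I_r => (i < j)%N) (fun _ _ => 1%N)) /=.
rewrite (exchange_big_dep xpredT) //= -bin2_sum big_mkord.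
apply: eq_bigr => j _.
by rewrite -(big_ord_widen r (fun=> 1%N) (ltnW (ltn_ord j))) sum1_card card_ord.
Qed.

(** The sign classes correspond to pairs of a sign class [C] of the Graver
basis and a pair of rows [i < j]: the image of [C] under [type2 i j] is again a
sign class, and exchanging the rows only changes the sign. *)
Lemma card_type2_graver r m n (A : 'M[nat]_(m, n)) k :
  (graver_basis A #= `I_k)%card ->
  (upto_sign (@type2_graver r m n A) #= `I_(k * 'C(r, 2)))%card.
Proof.
move=> cardG.
have /finite_fsetP[G eG] : finite_set (graver_basis A) by apply/finite_setP;
  exists k.
have cardGk : #|{: G}| = k.
  by rewrite -cardfE; apply/card_eq_fsetP; rewrite -eG.
pose P := {x : 'I_r * 'I_r | (x.1 < x.2)%N}.
pose F (C : set 'cV[int]_n) (x : 'I_r * 'I_r) := type2 x.1 x.2 @` C.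
have F_sign g x : F (sign_class g) x = sign_class (type2 x.1 x.2 g).
  rewrite /F /= /sign_class -type2N; apply/seteqP;
    split=> [_ [v [->|->] <-]|v [->|->]];
    by [left|right|exists g; [left|]|exists (- g); [right|]].
have GP (C : G) : graver_basis A (val C) by rewrite eG; apply: fsvalP.
have -> : upto_sign (@type2_graver r m n A) =
    (fun x : G * P => F (val x.1) (val x.2)) @` [set: G * P].
  apply/seteqP.
  split=> [_ [_ [i [j [g [ij Gg ->]]]] <-]|_ [[C [x lt_x]] _ <-] /=].
    have GCg : sign_class g \in G.
      by have : graver_basis A (sign_class g) by [exists g]; rewrite eG.
    have [lt_ij|lt_ji|e] := ltngtP i j; last by rewrite (val_inj e) eqxx in ij.
      by exists ([` GCg]%fset, exist _ (i, j) lt_ij); rewrite //= F_sign.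
    exists ([` GCg]%fset, exist _ (j, i) lt_ji); first by [].
    by rewrite /= F_sign /= type2_swap // type2N sign_classN.
  have [g Gg <-] := GP C; rewrite F_sign; exists (type2 x.1 x.2 g) => //.
  by exists x.1, x.2, g; split=> //; rewrite -val_eqE ltn_eqF.
apply: card_eq_trans (inj_card_eq _) _; last first.
  by rewrite -cardGk -card_ordered_pairs -card_prod; apply: card_setT_fin.
move=> [C [x lx]] [C' [x' lx']] _ _ /=.
have [g [_ g0 _] eC] := GP C; have [g' [_ g'0 _] eC'] := GP C'.
rewrite -eC -eC' !F_sign => /sign_class_eq e.
have ne_x : x.1 != x.2 by rewrite -val_eqE ltn_eqF.
have ne_x' : x'.1 != x'.2 by rewrite -val_eqE ltn_eqF.
have [h eh h0] : exists2 h,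
    type2 x.1 x.2 g = type2 x'.1 x'.2 h & h = g' \/ h = - g'.
  by case: e => ->; [exists g'; [|left]|exists (- g'); [rewrite type2N|right]].
have hn0 : h != 0 by case: h0 => ->; rewrite ?oppr_eq0.
(* The two rows are recovered as the support of the matrix. *)
have supp k0 : ((k0 == x.1) || (k0 == x.2)) = ((k0 == x'.1) || (k0 == x'.2)).
  have : (submxcol (type2 x.1 x.2 g) k0 != 0) =
      (submxcol (type2 x'.1 x'.2 h) k0 != 0).
    by rewrite eh.
  by rewrite !submxcol_type2; do 4!case: (k0 == _);
    rewrite ?oppr_eq0 ?g0 ?hn0 ?eqxx.
have xx' : x = x'.
  have suppn (k0 : 'I_r) : ((k0 == x.1 :> nat) || (k0 == x.2 :> nat)) =
    ((k0 == x'.1 :> nat) || (k0 == x'.2 :> nat)) := supp k0.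
  have := suppn x.1; have := suppn x.2; have := suppn x'.1; have := suppn x'.2.
  case: x x' lx lx' {eh supp suppn e ne_x ne_x'} => [x1 x2] [y1 y2] /= lx ly.
  by rewrite !eqxx ?orbT => *; congr (_, _); apply: val_inj => /=; lia.
subst x'; have e' : g = h := type2_inj eh.
congr (_, _); last by apply: val_inj.
apply: val_inj; rewrite /= -eC -eC' e'; case: h0 => -> //; exact: sign_classN.
Qed.

(** The complexity is read off the universal Markov basis, whose sign classes
are those of the Graver moves between two rows. *)
Theorem lawrence_universal_markov m n (A : 'M[nat]_(m, n)) (k : nat) :
  pointed A -> distance_reducing A -> (graver_basis A #= `I_k)%card ->
  (exists2 v, lattice A v & v != 0) ->
  is_markov_complexity A 2 /\
  forall r, (2 <= r)%N ->
    universal_markov_basis (lawrence r A) = indispensable (lawrence r A) /\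
    (universal_markov_basis (lawrence r A) #= `I_(k * 'C(r, 2)))%card.
Proof.
move=> ptA redA cardG [v Lv v0].
have fG : finite_set (graver_element A).
  have fB : finite_set (graver_basis A) by apply/finite_setP; exists k.
  have fU : finite_set (\bigcup_(C in graver_basis A) C).
    by apply: bigcup_finite => // _ [u _ <-]; apply: finite_set2.
  by apply: sub_finite_set fU => u Gu; exists (sign_class u); [exists u|left].
have univ r :
    universal_markov_basis (lawrence r A) = upto_sign (@type2_graver r m n A) /\
    indispensable (lawrence r A) = upto_sign (@type2_graver r m n A).
  apply: universal_of_indispensable; first exact: type2_graver_markov.
  by move=> M u; apply: type2_graver_indispensable.
split; last by move=> r _; have [-> ->] := univ r; split=> //;
  apply: card_type2_graver.
split=> [r u _|].
  have [-> _] := univ r; move/upto_signP => TT.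
  have [i [j [g [ij [_ g0 _] e]]]] : exists i j g,
      [/\ i != j, graver_element A g & u = type2 i j g].
    case: TT => -[i [j [g [ij Gg e]]]]; exists i, j; first by exists g.
    exists (- g); split=> //; first exact: graver_elementN.
    by rewrite type2N -e opprK.
  by rewrite e vtype_type2.
have [g Gg] := graver_exists Lv v0; have [_ g0 _] := Gg.
have ij : ord0 != ord_max :> 'I_2 by [].
exists 2, (type2 ord0 ord_max g); split=> //; last exact: vtype_type2.
have [-> _] := univ 2; apply/upto_signP; left.
by exists ord0, ord_max, g.
Qed.

(** * Positive rows *)

Section PositiveRow.
Variables (N : nat) (A : 'rV[nat]_N).
Hypothesis A_gt0 : forall c, (0 < A 0%R c)%N.

Lemma lattice_rowP v : lattice A v <-> \sum_c (A 0 c)%:Z * v c 0 = 0.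
Proof.
rewrite /lattice /=; split=> [/matrixP/(_ 0 0)|s0].
  by rewrite !mxE => s0; rewrite -[RHS]s0; apply: eq_bigr => c _; rewrite mxE.
apply/matrixP=> i j; rewrite !ord1 !mxE -[RHS]s0.
by apply: eq_bigr => c _; rewrite mxE.
Qed.

Lemma pointed_row : pointed A.
Proof.
move=> v /lattice_rowP s0 nv; apply/colP=> c; rewrite mxE.
have term0 i : 0 <= (A 0 i)%:Z * v i 0 by apply: mulr_ge0 => //; apply: nv.
have /eqP : (A 0 c)%:Z * v c 0 = 0.
  exact: (psumr_eq0P (fun i (_ : xpredT i) => term0 i) s0).
by rewrite mulf_eq0 => /orP[|/eqP//]; have := A_gt0 c; lia.
Qed.

Definition exchange i j : 'cV[int]_N :=
  \col_l (if l == i then (A 0 j)%:Z else if l == j then - (A 0 i)%:Z else 0).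

Lemma exchange_lattice i j : i != j -> lattice A (exchange i j).
Proof.
move=> ij; apply/lattice_rowP; rewrite (bigD1 i) // (bigD1 j) 1?eq_sym //=.
rewrite !mxE !eqxx eq_sym (negPf ij) big1 ?addr0; first by ring.
by move=> l /andP[/negPf li /negPf lj]; rewrite mxE li lj mulr0.
Qed.

Lemma exchange_neq0 i j : exchange i j != 0.
Proof.
apply/eqP => /colP/(_ i); rewrite !mxE eqxx; have := A_gt0 j; lia.
Qed.

(** If [u] had an entry above [S] at [i] and one below [- S] at [j], where [S]
is the sum of the row, then the exchange vector of [i] and [j] would be
conformal to [u], hence equal to it, but its entries are at most [S]. So one
side of [u] is bounded by [S], and the equation of the lattice bounds the other
side. *)
Lemma graver_row_bounded u c : graver_element A u ->
  `|u c 0| <= (\sum_c (A 0 c)%:Z) ^+ 2.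
Proof.
set S := \sum_c _.
have S0 : 0 <= S by apply: sumr_ge0.
have AS i : (A 0 i)%:Z <= S.
  by rewrite /S (bigD1 i) //= lerDl sumr_ge0.
have A1 i : 1 <= (A 0 i)%:Z by have := A_gt0 i; lia.
have one_side w : graver_element A w -> (forall i, w i 0 <= S) ->
    forall i, `|w i 0| <= S ^+ 2.
  move=> [/lattice_rowP s0 _ _] wS i.
  have wi : (A 0 i)%:Z * - w i 0 <= S ^+ 2.
    move/eqP: s0; rewrite (bigD1 i) //= addrC addr_eq0 -mulrN => /eqP <-.
    rewrite expr2 {1}/S mulr_suml [leRHS](bigD1 i) //= -[leLHS]add0r.
    apply: lerD; first by apply: mulr_ge0.
    by apply: ler_sum => l _; apply: ler_wpM2l.
  have := wS i; have := A1 i; have := AS i; rewrite expr2 in wi *.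
  move: wi; move: (w i 0) (A 0 i)%:Z => x y wi yS y1 xS.
  rewrite ler_norml; apply/andP; split; last by nia.
  by case: (lerP 0 x) => x0; nia.
move=> Gu; have [uS|/existsNP[i /negP]] := pselect (forall i, u i 0 <= S).
  exact: one_side.
rewrite -ltNge => ui.
suff uS j : (- u) j 0 <= S.
  by have := one_side _ (graver_elementN Gu) uS c; rewrite mxE normrN.
rewrite mxE leNgt; apply/negP => uj.
have ij : i != j by apply/eqP => e; move: ui uj S0; rewrite e;
  move: (u j 0) (S) => y z; lia.
have /graver_elementP[_ _ G] := Gu.
have [||v0|vu] := G (exchange i j).
- exact: exchange_lattice.
- move=> l; rewrite mxE; have [->|_] := eqVneq l i.
    by move: ui (AS j) (A1 j); move: (u i 0) (S) => x z; lia.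
  have [->|_] := eqVneq l j; last by move: (u l 0) => x; lia.
  by move: uj (AS i) (A1 i); move: (u j 0) (S) => x z; lia.
- by have /colP/(_ i) := v0; rewrite !mxE eqxx; have := A1 j; lia.
have /colP/(_ i) := vu; rewrite mxE eqxx.
by move: (AS j) ui; move: (u i 0) (S) => x z; lia.
Qed.

Lemma finite_bounded_vectors (B : int) : 0 <= B ->
  finite_set [set u : 'cV[int]_N | forall c, `|u c 0| <= B].
Proof.
move=> B0; pose b := `|B|%N.
apply: (@sub_finite_set _ _ ((fun x : 'cV['I_(b + b).+1]_N =>
    map_mx (fun i : 'I_(b + b).+1 => (i : nat)%:Z - B) x) @` setT)).
  move=> u uB; exists (map_mx (fun z : int => inord `|(z + B)%R|%N) u) => //.
  by apply/colP=> c; have := uB c; rewrite !mxE; move: (u c 0) => x xB;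
    rewrite inordK; lia.
exact/finite_image/finite_finset.
Qed.

Lemma graver_row_finite : finite_set (graver_element A).
Proof.
apply: sub_finite_set (finite_bounded_vectors (sqr_ge0 (\sum_c (A 0 c)%:Z))).
by move=> u Gu c; apply: graver_row_bounded.
Qed.

End PositiveRow.

(** * Distance reduction for glued triples *)

(** The conditions of [reduces] for the three entries of a row, listed in the
order in which the first two generators are the glued ones. *)
Definition reduces3 (v d d' : int * int * int) : Prop :=
  [/\ fits v.1.1 d.1.1 d'.1.1, fits v.1.2 d.1.2 d'.1.2, fits v.2 d.2 d'.2 &
      [\/ drops v.1.1 d.1.1 d'.1.1, drops v.1.2 d.1.2 d'.1.2
        | drops v.2 d.2 d'.2]].

(** A move made at either of the two points with difference rows [d], [d']. *)
Definition reduces3_sym (v d d' : int * int * int) : Prop :=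
  reduces3 v d d' \/
  reduces3 (- v) (- d) (- d').

Definition swap12 (v : int * int * int) : int * int * int :=
  (v.1.2, v.1.1, v.2).

Lemma reduces3_swap v d d' :
  reduces3 (swap12 v) (swap12 d) (swap12 d') -> reduces3 v d d'.
Proof.
case: v d d' => [[? ?] ?] [[? ?] ?] [[? ?] ?]; rewrite /swap12 /=.
by case=> /= f1 f2 f3 dr; split=> //=; case: dr => dr;
  [constructor 2|constructor 1|constructor 3].
Qed.

Lemma reduces3_sym_swap v d d' :
  reduces3_sym (swap12 v) (swap12 d) (swap12 d') -> reduces3_sym v d d'.
Proof. by case=> h; [left|right]; apply: reduces3_swap. Qed.

Lemma reduces3_symC v d d' : reduces3_sym v d d' -> reduces3_sym v (- d') (- d).
Proof.
have C u e e' : reduces3 u e e' -> reduces3 (- u) e' e.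
  case: u e e' => [[? ?] ?] [[? ?] ?] [[? ?] ?];
    rewrite /reduces3 /fits /drops /=.
  by case=> f1 f2 f3 dr; split; try lia; case: dr => dr;
    [constructor 1|constructor 2|constructor 3]; lia.
by case=> /C; rewrite ?opprK; [right; rewrite !opprK|left].
Qed.

Lemma reduces3_sym_irr v d : ~ reduces3_sym v d d.
Proof.
have irr u e : ~ reduces3 u e e.
  case: u e => [[? ?] ?] [[? ?] ?]; rewrite /reduces3 /fits /drops /=.
  by case=> f1 f2 f3 [] dr; lia.
by case; apply: irr.
Qed.

(** Rows with [q] of opposite signs that leave the interval on the same side.
Both first entries, up to sign, are at least [A + N], so only the second
entries [y = B q - M p] matter. If [y >= B] for the first row or for the
opposite of the second, a move by [row 0 1] is possible; if [y <= B - M], a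
move by [row 1 1], whose second entry is negative. Otherwise both values of [y]
lie strictly between [B - M] and [B]; by the width of this window a row with
smaller [q] cannot have larger [p], up to sign, so that this whole row can be
cancelled; the sign of its [y] decides at which end the move is made. *)
Lemma reduce_same_side (A B M N δ P Q P' Q' : int) :
  0 <= A -> 0 <= B -> B < M -> 0 <= N -> 0 < δ ->
  1 <= P -> 1 <= Q -> 1 <= P' -> 1 <= Q' ->
  let row p q := (A * q + N * p, B * q - M * p, - (δ * q)) in
  exists p q, reduces3_sym (row p q) (row P Q) (row (- P') (- Q')).
Proof.
move=> A0 B0 BM N0 d0 P1 Q1 P1' Q1' row.
have rowN p q : row (- p) (- q) = - row p q by congr (_, _, _) => /=; ring.
pose y p q := B * q - M * p.
have fit3 q0 q q' : 0 <= q0 -> q0 <= q' ->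
    fits (- (δ * q0)) (- (δ * q)) (- (δ * - q')).
  by rewrite /fits => ? ?; split; [left|right]; nia.
have drop3 q0 q q' : 0 < q0 -> 0 < q ->
    drops (- (δ * q0)) (- (δ * q)) (- (δ * - q')).
  by rewrite /drops => ? ?; right; split; nia.
have half S R S' R' : 1 <= S -> 1 <= R -> 1 <= S' -> 1 <= R' ->
    [\/ B <= y S R, y S' R' <= B - M |
      [/\ R' <= R, y S R < B & B - M < y S' R'] ] ->
    exists p q, reduces3_sym (row p q) (row S R) (row (- S') (- R')).
  move=> S1 R1 S1' R1'.
  have X0 : A + N <= A * R + N * S by nia.
  case=> [hy|hy|[leR hy hy']].
  - exists 0, 1; left; split=> //=; last by constructor 3; apply: drop3.
    + by rewrite /fits; lia.
    + by rewrite /fits; rewrite /y in hy; lia.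
    + exact: fit3.
  - exists 1, 1; left; split=> //=; last by constructor 3; apply: drop3.
    + by rewrite /fits; lia.
    + by rewrite /fits; rewrite /y in hy; lia.
    + exact: fit3.
  have leS : S' <= S.
    rewrite leNgt; apply/negP => ltS; rewrite /y in hy hy'.
    have : B * R' <= B * R by apply: ler_wpM2l.
    have : M * (S + 1) <= M * S' by apply: ler_wpM2l; lia.
    lia.
  have X1 : A * R' + N * S' <= A * R + N * S by nia.
  exists S', R'; case: (lerP (y S' R') 0) => sy; rewrite /y in hy hy' sy.
    left; split=> //=.
    + by rewrite /fits; nia.
    + by rewrite /fits; lia.
    + by apply: fit3; lia.
    by constructor 3; apply: drop3; lia.
  right; rewrite -!rowN !opprK; split=> /=; rewrite /fits /drops; try nia.
  by constructor 3; left; nia.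
(* Negating both rows and exchanging them is a symmetry of the problem. *)
have swap :
    (exists p q, reduces3_sym (row p q) (row P' Q') (row (- P) (- Q))) ->
    exists p q, reduces3_sym (row p q) (row P Q) (row (- P') (- Q')).
  by case=> p [q /reduces3_symC]; rewrite -!rowN !opprK => h; exists p, q.
have [h|h1] := lerP B (y P Q); first by apply: half => //; constructor 1.
have [h|h2] := lerP (y P' Q') (B - M); first by apply: half => //;
  constructor 2.
have [h|h3] := lerP B (y P' Q'); first by apply/swap/half => //; constructor 1.
have [h|h4] := lerP (y P Q) (B - M); first by apply/swap/half => //;
  constructor 2.
have [h|/ltW h] := lerP Q' Q; first by apply: half => //; constructor 3.
by apply/swap/half => //; constructor 3.
Qed.

Lemma ltr0_sum_exists (I : finType) (f : I -> int) :
  \sum_i f i = 0 -> (exists i, 0 < f i) -> exists i, f i < 0.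
Proof.
move=> s0 [i fi]; apply: contrapT => noneg.
have f0 j : 0 <= f j by rewrite leNgt; apply/negP => h; apply: noneg; exists j.
by have /(_ s0 i isT) fi0 := @psumr_eq0P _ _ xpredT f (fun j _ => f0 j);
  rewrite fi0 ltxx in fi.
Qed.

Lemma gtr0_sum_exists (I : finType) (f : I -> int) :
  \sum_i f i = 0 -> (exists i, f i < 0) -> exists i, 0 < f i.
Proof.
move=> s0 [i fi].
have [||j hj] := @ltr0_sum_exists _ (fun i => - f i).
- by rewrite sumrN s0 oppr0.
- by exists i; rewrite oppr_gt0.
by exists j; rewrite -oppr_lt0.
Qed.

Section GluedRows.
Variables (a b κ m1 m2 δ : int).
Hypotheses (a_ge0 : 0 <= a) (a_lt : a < m2) (b_ge0 : 0 <= b) (b_lt : b < m1).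
Hypotheses (k_ge0 : 0 <= κ) (d_gt0 : 0 < δ).

(** The lattice vector with coordinates [p], [q] in the basis [(m2, - m1, 0)],
[(a, b + κ m1, - δ)]. *)
Definition glued_row (p q : int) : int * int * int :=
  (a * q + m2 * p, (b + κ * m1) * q - m1 * p, - (δ * q)).

Let m1_gt0 : 0 < m1. Proof. lia. Qed.
Let m2_gt0 : 0 < m2. Proof. lia. Qed.

Lemma glued_rowN p q : glued_row (- p) (- q) = - glued_row p q.
Proof. by congr (_, _, _) => /=; ring. Qed.

Let reducible p q p' q' :=
  exists P Q, reduces3_sym (glued_row P Q) (glued_row p q) (glued_row p' q').

Lemma reducibleC (p q p' q' : int) :
  reducible p q p' q' -> reducible (- p') (- q') (- p) (- q).
Proof. by case=> P [Q /reduces3_symC h]; exists P, Q; rewrite !glued_rowN. Qed.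

(** For [p] in the interval from 0 to [κ q], the vector with first coordinate
[min p κ] and second coordinate 1 has nonnegative first entries, and these are
at most those of the given row. *)
Lemma reducible_rich (p q p' q' : int) :
  0 < q -> q' < 0 -> 0 <= p -> p <= κ * q -> reducible p q p' q'.
Proof.
move=> q0 q0' p0 pk; exists (Num.min p κ), 1; left.
have [lep|/ltW lep] := leP p κ; split=> /=; rewrite /fits /drops;
  try by constructor 3; nia.
- by split; [right|left]; nia.
- by split; [right|left]; nia.
- by split; [left|right]; nia.
- by split; [right|left]; nia.
- split; last by left; nia.
  right; rewrite -subr_ge0.
  have -> : (b + κ * m1) * q - m1 * p - ((b + κ * m1) * 1 - m1 * κ) =
    b * (q - 1) + m1 * (κ * q - p) by ring.
  by nia.
- by split; [left|right]; nia.
Qed.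

(** Replacing [p] by [p - κ q] turns this into [reduce_same_side]. *)
Lemma reducible_right (p q p' q' : int) :
  0 < q -> q' < 0 -> κ * q < p -> p' < κ * q' -> reducible p q p' q'.
Proof.
move=> q0 q0' kp kp'.
pose row (p q : int) : int * int * int :=
  ((a + κ * m2) * q + m2 * p, b * q - m1 * p, - (δ * q)).
have rowE s t : glued_row s t = row (s - κ * t) t.
  by congr (_, _, _); ring.
have := @reduce_same_side (a + κ * m2) b m1 m2 δ
    (p - κ * q) q (- (p' - κ * q')) (- q').
rewrite -!/(row _ _) !opprK; case; try lia.
move=> P [Q h]; by exists (P + κ * Q), Q; rewrite !rowE addrK.
Qed.

(** Exchanging the first two entries turns this into [reduce_same_side]. *)
Lemma reducible_left (p q p' q' : int) :
  0 < q -> q' < 0 -> p < 0 -> 0 < p' -> reducible p q p' q'.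
Proof.
move=> q0 q0' p0 p0'.
pose row (p q : int) : int * int * int :=
  ((b + κ * m1) * q + m1 * p, a * q - m2 * p, - (δ * q)).
have rowE s t : swap12 (glued_row s t) = row (- s) t.
  by congr (_, _, _); rewrite /=; ring.
have := @reduce_same_side (b + κ * m1) a m2 m1 δ (- p) q p' (- q').
rewrite -!/(row _ _) !opprK; case; try lia.
move=> P [Q h]; by exists (- P), Q; apply: reduces3_sym_swap;
  rewrite !rowE opprK.
Qed.

(** The move by [(m2, - m1, 0)] itself. *)
Lemma reducible_flat (p q p' : int) :
  0 <= q -> 0 < p -> p' < 0 -> reducible p q p' 0.
Proof.
move=> q0 p0 p0'; exists 1, 0; left; split=> /=; rewrite /fits /drops; try nia.
by constructor 1; nia.
Qed.

(** If no row lies in its interval and no two rows leave it on the same side,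
then all rows with [q > 0] leave it on one side and all opposites of those with
[q < 0] on the other, so that all their [p] have the same sign. A row with
[q = 0] and [p] of the other sign then remains for [reducible_flat]. *)
Lemma reducible_pair (I : finType) (p q : I -> int) :
  \sum_i p i = 0 -> \sum_i q i = 0 -> (exists i, (p i != 0) || (q i != 0)) ->
  exists i j, reducible (p i) (q i) (p j) (q j).
Proof.
move=> sp sq [i0 nz]; apply: contrapT => none.
have no i j : ~ reducible (p i) (q i) (p j) (q j) by move=> h; apply: none;
  exists i, j.
have flat i l : q l = 0 -> ~ [/\ 0 <= q i, 0 < p i & p l < 0].
  by move=> ql [? ? ?]; apply: (no i l); rewrite ql; apply: reducible_flat.
have flat' i l : q l = 0 -> ~ [/\ q i <= 0, p i < 0 & 0 < p l].
  move=> ql [? ? ?]; apply: (no l i).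
  rewrite -[p l]opprK -[q l]opprK -[p i]opprK -[q i]opprK.
  by apply: reducibleC; rewrite ql oppr0; apply: reducible_flat; lia.
have [q0|/existsNP [i1 /eqP nzq]] := pselect (forall i, q i = 0).
  rewrite q0 eqxx orbF in nz.
  have [l pl] : exists i, 0 < p i.
    have [h|h|/eqP h] := ltgtP (p i0) 0; [|by exists i0|by rewrite h in nz].
    by apply: gtr0_sum_exists => //; exists i0.
  have [l' pl'] : exists i, p i < 0 by apply: ltr0_sum_exists => //; exists l.
  by apply: (@flat l l'); rewrite ?q0.
have [i qi] : exists i, 0 < q i.
  have [h|h|/eqP h] := ltgtP (q i1) 0; [|by exists i1|by rewrite h in nzq].
  by apply: gtr0_sum_exists => //; exists i1.
have [j qj] : exists j, q j < 0 by apply: ltr0_sum_exists => //; exists i.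
have upper u : 0 < q u -> p u < 0 \/ κ * q u < p u.
  move=> qu; have [h|h] := ltP (p u) 0; first by left.
  have [h'|h'] := ltP (κ * q u) (p u); first by right.
  by case: (@no u j); apply: reducible_rich.
have lower l : q l < 0 -> 0 < p l \/ p l < κ * q l.
  move=> ql; have [h|h] := ltP 0 (p l); first by left.
  have [h'|h'] := ltP (p l) (κ * q l); first by right.
  case: (@no i l); rewrite -[p l]opprK -[q l]opprK -[p i]opprK -[q i]opprK.
  by apply: reducibleC; apply: reducible_rich; lia.
have right u l : 0 < q u -> q l < 0 -> κ * q u < p u -> p l < κ * q l -> False.
  by move=> ? ? ? ?; apply: (@no u l); apply: reducible_right.
have left u l : 0 < q u -> q l < 0 -> p u < 0 -> 0 < p l -> False.
  by move=> ? ? ? ?; apply: (@no u l); apply: reducible_left.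
have qk s : 0 < s -> 0 <= κ * s by nia.
have qk' s : s < 0 -> κ * s <= 0 by nia.
have [pi|pi] := upper i qi.
- have lowP l : q l < 0 -> p l < κ * q l.
    by move=> ql; case: (lower l ql) => // h; case: (left i l).
  have upP u : 0 < q u -> p u < 0.
    by move=> qu; case: (upper u qu) => // h; case: (right u j) => //;
      apply: lowP.
  have [||l pl] := @gtr0_sum_exists _ p; [by []|by exists i|].
  have ql : q l = 0.
    have [h|h|//] := ltgtP (q l) 0; first by have := lowP l h; have := qk' _ h;
      lia.
    by have := upP l h; lia.
  apply: (@flat' j l ql); split; [lia| |by []].
  by have := lowP j qj; have := qk' _ qj; lia.
have lowP l : q l < 0 -> 0 < p l.
  by move=> ql; case: (lower l ql) => // h; case: (right i l).
have upP u : 0 < q u -> κ * q u < p u.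
  by move=> qu; case: (upper u qu) => // h; case: (left u j) => //; apply: lowP.
have pi0 : 0 < p i by have := qk _ qi; lia.
have [||l pl] := @ltr0_sum_exists _ p; [by []|by exists i|].
have ql : q l = 0.
  have [h|h|//] := ltgtP (q l) 0; first by have := lowP l h; lia.
  by have := upP l h; have := qk _ h; lia.
by apply: (@flat i l ql); split; [lia| |].
Qed.

End GluedRows.

Lemma ord3_perm (i1 i2 i3 : 'I_3) : uniq [:: i1; i2; i3] ->
  perm_eq (enum 'I_3) [:: i1; i2; i3].
Proof.
move=> u; apply: uniq_perm => //; first exact: enum_uniq.
have sub : {subset [:: i1; i2; i3] <= enum 'I_3} by move=> i _;
  rewrite mem_enum.
by have [|_ e i] := uniq_min_size u sub; rewrite ?size_enum_ord ?e.
Qed.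

Lemma sum_ord3 (V : nmodType) (i1 i2 i3 : 'I_3) (f : 'I_3 -> V) :
  uniq [:: i1; i2; i3] -> \sum_i f i = f i1 + f i2 + f i3.
Proof.
move=> /ord3_perm p; rewrite -big_enum /= (perm_big _ p) /=.
by rewrite !big_cons big_nil addr0 addrA.
Qed.

Lemma ord3_cases (i1 i2 i3 : 'I_3) : uniq [:: i1; i2; i3] ->
  forall c, [\/ c = i1, c = i2 | c = i3].
Proof.
move=> /ord3_perm/perm_mem p c; have := p c; rewrite mem_enum !inE => /esym.
by case/or3P=> /eqP ->; [constructor 1|constructor 2|constructor 3].
Qed.

Lemma glued_rowP (d m1 m2 n3 : nat) (a b κ x y z : int) :
  (0 < d)%N -> coprime d n3 -> (0 < m1)%N -> (0 < m2)%N -> coprime m1 m2 ->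
  n3%:Z = m1%:Z * a + m2%:Z * b + κ * (m1%:Z * m2%:Z) ->
  (d * m1)%:Z * x + (d * m2)%:Z * y + n3%:Z * z = 0 ->
  exists p q, (x, y, z) = glued_row a b κ m1 m2 d p q.
Proof.
move=> d0 dn3 m10 m20 m12 e rel; rewrite !PoszM in rel.
have /dvdzP[q eq] : (d %| z)%Z.
  rewrite -(@Gauss_dvdzr d n3) //; apply/dvdzP;
    exists (- (m1%:Z * x + m2%:Z * y)).
  apply/eqP; rewrite -subr_eq0 -[X in _ == X]rel; apply/eqP; ring.
have relq : m1%:Z * (x + a * q) = m2%:Z * (- y - (b + κ * m1%:Z) * q).
  have d0' : d%:Z != 0 by lia.
  apply: (mulfI d0'); apply/eqP; rewrite -subr_eq0 -[X in _ == X]rel eq e;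
    apply/eqP; ring.
have /dvdzP[p ep] : (m2 %| x + a * q)%Z.
  rewrite -(@Gauss_dvdzr m2 m1) ?relq ?dvdz_mulr //.
  by rewrite coprimezE /= coprime_sym.
exists p, (- q); rewrite /glued_row.
have ex : x = - (a * q) + m2%:Z * p by rewrite [_ * p]mulrC -ep; ring.
have m20' : m2%:Z != 0 by lia.
have ey : y = - ((b + κ * m1%:Z) * q) - m1%:Z * p.
  apply: (mulfI m20'); apply/eqP; rewrite -subr_eq0.
  have : m2%:Z * (- y - (b + κ * m1%:Z) * q) - m1%:Z * (p * m2%:Z) = 0
    by rewrite -ep relq subrr.
  by move=> h; rewrite -oppr_eq0 -[X in _ == X]h; apply/eqP; ring.
by rewrite eq {1}ex {1}ey; congr (_, _, _); ring.
Qed.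

(** The third generator times the gcd of the first two lies in the semigroup of
these two: the semigroup of [A] is a gluing. *)
Definition glued (A : 'rV[nat]_3) (i1 i2 i3 : 'I_3) : Prop :=
  exists s t, (gcdn (A 0%R i1) (A 0%R i2) * A 0%R i3 =
                 s * A 0%R i1 + t * A 0%R i2)%N.

Lemma glued_distance_reducing (A : 'rV[nat]_3) (i1 i2 i3 : 'I_3) :
  (forall c, (0 < A 0%R c)%N) ->
  (gcdn (gcdn (A 0%R i1) (A 0%R i2)) (A 0%R i3) = 1)%N ->
  uniq [:: i1; i2; i3] -> glued A i1 i2 i3 -> distance_reducing A.
Proof.
move=> A_gt0 gcd1 uniqi [s [t est]] r D LD sD [k0 Dk0].
set d := gcdn (A 0 i1) (A 0 i2) in gcd1 est.
have d_gt0 : (0 < d)%N by rewrite gcdn_gt0 A_gt0.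
have [m1 e1] : exists m1, A 0 i1 = (d * m1)%N.
  by have /dvdnP[m1 ->] := dvdn_gcdl (A 0%R i1) (A 0%R i2); exists m1;
    rewrite mulnC.
have [m2 e2] : exists m2, A 0 i2 = (d * m2)%N.
  by have /dvdnP[m2 ->] := dvdn_gcdr (A 0%R i1) (A 0%R i2); exists m2;
    rewrite mulnC.
have m1_gt0 : (0 < m1)%N by have := A_gt0 i1; rewrite e1 muln_gt0 => /andP[].
have m2_gt0 : (0 < m2)%N by have := A_gt0 i2; rewrite e2 muln_gt0 => /andP[].
have m12 : coprime m1 m2.
  have : (d * gcdn m1 m2 = d * 1)%N by rewrite muln_gcdr -e1 -e2 muln1.
  by move/eqP; rewrite eqn_pmul2l.
set n3 := A 0 i3 in gcd1 est.
have en3 : n3 = (s * m1 + t * m2)%N.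
  by apply/eqP; rewrite -(eqn_pmul2l d_gt0) est e1 e2; apply/eqP; ring.
(* Normalise n3 = s m1 + t m2: reduce s modulo m2, then t modulo m1. *)
pose b' := (t + m1 * (s %/ m2))%N.
pose a := (s %% m2)%N; pose b := (b' %% m1)%N; pose κ := (b' %/ m1)%N.
have a_lt : (a < m2)%N by rewrite ltn_mod.
have b_lt : (b < m1)%N by rewrite ltn_mod.
have e3 : n3%:Z = m1%:Z * a%:Z + m2%:Z * b%:Z + κ%:Z * (m1%:Z * m2%:Z).
  have es : s = ((s %/ m2) * m2 + a)%N by apply: divn_eq.
  have eb : (t + m1 * (s %/ m2))%N = (κ * m1 + b)%N by apply: divn_eq.
  rewrite en3 -!PoszM -!PoszD; congr Posz.
  suff : (s * m1 + t * m2 = m1 * a + m2 * (κ * m1 + b))%N by move=> ->; ring.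
  by rewrite -eb {1}es; ring.
pose row := glued_row a b κ m1 m2 d.
pose coords (v : 'cV[int]_3) := (v i1 0, v i2 0, v i3 0).
have LE v : lattice A v <->
    (d * m1)%:Z * v i1 0 + (d * m2)%:Z * v i2 0 + n3%:Z * v i3 0 = 0.
  by rewrite -e1 -e2 /n3; split=> [/lattice_rowP|h];
    rewrite ?(sum_ord3 _ uniqi) //;
     apply/lattice_rowP; rewrite (sum_ord3 _ uniqi).
have rows k : exists pq : int * int, coords (D k) = row pq.1 pq.2.
  have /LE rel := LD k.
  have [p [q e]] :=
    glued_rowP d_gt0 (introT eqP gcd1) m1_gt0 m2_gt0 m12 e3 rel.
  by exists (p, q).
have [f Df] := boolp.choice rows.
have DE k : [/\ D k i1 0 = a%:Z * (f k).2 + m2%:Z * (f k).1,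
    D k i2 0 = (b%:Z + κ%:Z * m1%:Z) * (f k).2 - m1%:Z * (f k).1 &
    D k i3 0 = - (d%:Z * (f k).2)].
  by case: (Df k) => -> -> ->.
have sum3 : (\sum_k D k i1 0 = 0) /\ (\sum_k D k i3 0 = 0).
  by split; rewrite -summxE sD mxE.
have sq : \sum_k (f k).2 = 0.
  case: sum3 => _; rewrite (eq_bigr (fun k => - d%:Z * (f k).2)); last first.
    by move=> k _; case: (DE k) => _ _ ->; rewrite mulNr.
  by move/eqP; rewrite -mulr_sumr mulf_eq0 => /orP[|/eqP//]; lia.
have sp : \sum_k (f k).1 = 0.
  case: sum3 => + _.
  rewrite (eq_bigr (fun k => a%:Z * (f k).2 + m2%:Z * (f k).1)); last first.
    by move=> k _; case: (DE k).
  rewrite big_split /= -!mulr_sumr sq mulr0 add0r.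
  by move/eqP; rewrite mulf_eq0 => /orP[|/eqP//]; lia.
have [i [j [P [Q red]]]] : exists i j P Q,
    reduces3_sym (row P Q) (row (f i).1 (f i).2) (row (f j).1 (f j).2).
  apply: (@reducible_pair a b κ m1 m2 d _ _ _ _ _ _ _
    (fun k => (f k).1) (fun k => (f k).2)) => //; try lia.
  exists k0; apply: contraTT Dk0; rewrite negb_or !negbK
    => /andP[/eqP p0 /eqP q0].
  have [] := DE k0; rewrite p0 q0 !mulr0 subrr oppr0 => x0 y0 z0.
  apply/eqP/colP=> c; rewrite mxE.
  by case: (ord3_cases uniqi c) => ->.
pose v : 'cV[int]_3 := \col_c (if c == i1 then (row P Q).1.1
  else if c == i2 then (row P Q).1.2 else (row P Q).2).
have [n12 n13 n23] : [/\ i1 != i2, i1 != i3 & i2 != i3].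
  by move: uniqi; rewrite /= !inE negb_or => /andP[/andP[-> ->] /andP[->]].
have vrow : coords v = row P Q.
  rewrite /coords !mxE eqxx ![_ == i1]eq_sym (negPf n12) (negPf n13).
  by rewrite eqxx eq_sym (negPf n23).
have Lv : lattice A v.
  apply/LE; case: vrow => -> -> ->; rewrite e3 !PoszM; ring.
have red_vec u x y : reduces3 (coords u) (coords x) (coords y) -> reduces u x y.
  case=> /= f1 f2 f3 dr; split=> [c|].
    by case: (ord3_cases uniqi c) => ->.
  by case: dr => ?; [exists i1|exists i2|exists i3].
have coordsN u : coords (- u) = - coords u by rewrite /coords !mxE.
rewrite -!Df -vrow in red; exists i, j, v; split=> //.
  by apply/eqP => e; move: red; rewrite e; apply: reduces3_sym_irr.
by case: red => red; [left|right]; apply: red_vec; rewrite ?coordsN.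
Qed.

(** * Complete intersections *)

Section ToricIdeal.
Variables (K : fieldType) (N : nat) (A : 'rV[nat]_N).
Implicit Types (u w : 'X_{1..N}) (p q : {mpoly K[N]}).

Definition weight u : nat := (\sum_c u c * A 0%R c)%N.

Lemma lattice_weight u w :
  lattice A (\col_c ((u c)%:Z - (w c)%:Z)) <-> weight u = weight w.
Proof.
have -> : lattice A (\col_c ((u c)%:Z - (w c)%:Z)) <->
    (weight u)%:Z - (weight w)%:Z = 0.
  have wE x : (weight x)%:Z = \sum_c (A 0%R c)%:Z * (x c)%:Z.
    by rewrite raddf_sum; apply: eq_bigr => c _ /=; rewrite mulnC PoszM.
  have e : \sum_c (A 0 c)%:Z * (\col_c ((u c)%:Z - (w c)%:Z)) c 0 =
      (weight u)%:Z - (weight w)%:Z.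
    by rewrite !wE -sumrB; apply: eq_bigr => c _; rewrite mxE mulrBr.
  by split=> [/lattice_rowP <-|h]; rewrite ?e //; apply/lattice_rowP; rewrite e.
by split=> [/subr0_eq[]|->] //; rewrite subrr.
Qed.

Lemma toric_binomial u w : weight u = weight w ->
  toric_ideal K A ('X_[u] - 'X_[w]).
Proof.
move=> /lattice_weight Luw.
exists [:: (1, 'X_[u] - 'X_[w])]; last by rewrite big_seq1 mul1r.
by move=> q; rewrite inE => /eqP ->; exists u, w.
Qed.

(** The substitution [x_c = t ^ n_c], whose kernel contains the toric ideal. *)
Definition monomial_curve : {rmorphism {mpoly K[N]} -> {poly K}} :=
  mmap (@polyC K) (fun c => 'X^(A 0 c)).

Lemma monomial_curveX u : monomial_curve 'X_[u] = 'X^(weight u).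
Proof.
rewrite /monomial_curve /= mmapX /mmap1 /weight -prodrXr.
by apply: eq_bigr => c _; rewrite -exprM mulnC.
Qed.

Lemma toric_monomial_curve p : toric_ideal K A p -> monomial_curve p = 0.
Proof.
move=> [s Ss ->]; rewrite rmorph_sum big_seq big1 // => q /Ss [u [w [Luw ->]]].
rewrite rmorphM rmorphB !monomial_curveX.
by have /lattice_weight -> := Luw; rewrite subrr mulr0.
Qed.

(** If [x ^ u] is alone in its weight, its coefficient is read off the image of
[p] under the substitution. *)
Lemma coef_unique_weight p u : toric_ideal K A p ->
  (forall w, weight w = weight u -> w = u) -> p@_u = 0.
Proof.
move=> /toric_monomial_curve phi0 uniq_u.
have : (monomial_curve p)`_(weight u) = 0 by rewrite phi0 coef0.
rewrite /monomial_curve /= /mmap coef_sum.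
under eq_bigr => w _.
  have -> : mmap1 (fun c : 'I_N => 'X^(A 0 c) : {poly K}) w = 'X^(weight w).
    by rewrite -monomial_curveX /monomial_curve /= mmapX.
  rewrite coefCM coefXn; over.
have [u_p|/memN_msupp_eq0//] := boolP (u \in msupp p).
rewrite (bigD1_seq u) ?msupp_uniq //= eqxx mulr1 big1 ?addr0 // => w wu.
have [/esym/uniq_u e|_] := eqVneq; last by rewrite mulr0.
by rewrite e eqxx in wu.
Qed.

Definition pure_multiple (i : 'I_N) (e : nat) : Prop :=
  (0 < e)%N /\ exists2 u : 'X_{1..N}, u i = 0%N & weight u = (e * A 0%R i)%N.

Definition least_multiple (i : 'I_N) (e : nat) : Prop :=
  pure_multiple i e /\ forall e', pure_multiple i e' -> (e <= e')%N.

Lemma weight_power i e : weight (U_(i) *+ e)%MM = (e * A 0%R i)%N.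
Proof.
rewrite /weight (bigD1 i) //= mulmnE mnm1E eqxx mul1n big1 ?addn0 // => j.
by rewrite mulmnE mnm1E eq_sym => /negPf ->.
Qed.

Lemma weightD u w : weight (u + w)%MM = (weight u + weight w)%N.
Proof.
rewrite /weight -big_split /=; apply: eq_bigr => c _.
by rewrite mnmDE mulnDl.
Qed.

Hypothesis A_gt0 : forall c, (0 < A 0%R c)%N.

Lemma weight_eq0 u : weight u = 0%N -> u = 0%MM.
Proof.
move=> /eqP; rewrite sum_nat_eq0 => /forallP u0; apply/mnmP=> i.
have /implyP/(_ isT) := u0 i; rewrite muln_eq0 mnm0E => /orP[/eqP//|].
by have := A_gt0 i; case: (A _ _).
Qed.

(** Dividing another monomial of this weight by its power of [x_i] would give a
smaller multiple of [n_i] in the semigroup of the other generators. *)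
Lemma unique_below_least i c e u : least_multiple i c -> (e < c)%N ->
  weight u = weight (U_(i) *+ e)%MM -> u = (U_(i) *+ e)%MM.
Proof.
rewrite weight_power => -[_ minc] lt_ec we.
pose u' := [multinom if j == i then 0%N else u j | j < N].
have eu : u = (U_(i) *+ u i + u')%MM.
  apply/mnmP=> j; rewrite mnmDE mulmnE mnm1E mnmE eq_sym.
  by case: eqVneq => [->|_]; rewrite ?mul1n ?addn0.
have wu' : (u i * A 0%R i + weight u' = e * A 0%R i)%N.
  by rewrite -we [in RHS]eu weightD weight_power.
have le_ui : (u i <= e)%N.
  by rewrite -(leq_pmul2r (A_gt0 i)) -wu' leq_addr.
have we' : weight u' = ((e - u i) * A 0%R i)%N by rewrite mulnBl -wu' addKn.
have [lt_ui|ge_ui] := ltnP (u i) e.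
  have /minc : pure_multiple i (e - u i).
    by split; [rewrite subn_gt0|exists u'; rewrite // mnmE eqxx].
  by move=> h; have := leq_trans h (leq_subr _ _); rewrite leqNgt lt_ec.
have ei : u i = e by apply/eqP; rewrite eqn_leq le_ui.
by rewrite eu ei (@weight_eq0 u') ?addm0 // we' ei subnn.
Qed.

(** The coefficients of lower powers of [x_i] vanish on the toric ideal, so
this coefficient is a functional that vanishes on the products with the maximal
ideal of the origin. *)
Lemma coef_power_mul i c p q : least_multiple i c -> toric_ideal K A p ->
  (q * p)@_(U_(i) *+ c) = q@_0%MM * p@_(U_(i) *+ c).
Proof.
move=> minc Ip; set m := (U_(i) *+ c)%MM.
have lt_m : (mdeg m < (mdeg m).+1)%N by [].
rewrite mcoeffM (bigD1 (bm0, BMultinom lt_m)) ?add0m //= big1 ?addr0 //.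
move=> [[x ltx] [y lty]] /= /andP[/eqP e ne].
have yE : y = (U_(i) *+ y i)%MM.
  apply/mnmP=> j; rewrite mulmnE mnm1E; have [<-|ij] := eqVneq i j;
    first by rewrite mul1n.
  have /mnmP/(_ j) := e; rewrite mnmDE mulmnE mnm1E (negPf ij) mul0n
    => /esym/eqP.
  by rewrite addn_eq0 => /andP[_ /eqP].
have eci : c = (x i + y i)%N.
  by have /mnmP/(_ i) := e; rewrite mnmDE mulmnE mnm1E eqxx mul1n.
have [lt_y|ge_y] := ltnP (y i) c.
  rewrite [p@_y](coef_unique_weight Ip) ?mulr0 // => w.
  by rewrite yE; apply: unique_below_least minc lt_y.
have ym : y = m by rewrite yE /m; congr (_ *+ _)%MM; lia.
have x0 : x = 0%MM.
  apply/mnmP=> j; have /mnmP/(_ j) := e; rewrite mnmDE -/m ym mnm0E => h; lia.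
by case/eqP: ne; congr (_, _); apply: val_inj.
Qed.

End ToricIdeal.

Section CompleteIntersection.
Variables (K : fieldType) (A : 'rV[nat]_3).
Hypothesis A_gt0 : forall c, (0 < A 0%R c)%N.

Lemma least_multiple_exists i : exists c, least_multiple A i c.
Proof.
have ex : exists c, `[< pure_multiple A i c >].
  have [j ji] : exists j : 'I_3, j != i.
    by exists (i + 1); rewrite -subr_eq0 addrAC subrr add0r.
  exists (A 0%R j); apply/asboolP; split=> //.
  exists (U_(j) *+ A 0%R i)%MM; last by rewrite weight_power mulnC.
  by rewrite mulmnE mnm1E (negPf ji).
exists (ex_minn ex); case: ex_minnP => c /asboolP Pc minc; split=> // e Pe.
by apply: minc; apply/asboolP.
Qed.

(** The functionals of [coef_power_mul] factor through the span of the values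
at two generators. If no two least multiples agree, they are dual to the three
binomials [x_i ^ c_i - x ^ u_i], where [u_i] does not involve [x_i]: the
identity of order 3 would have rank at most 2. *)
Lemma complete_intersection_equal_multiples : complete_intersection3 K A ->
  exists i j ci, [/\ i != j, least_multiple A i ci &
    exists cj, (ci * A 0%R i = cj * A 0%R j)%N].
Proof.
move=> [f [g Ifg]]; apply: contrapT => none.
have [c minc] := boolp.choice least_multiple_exists.
pose m i := (U_(i) *+ c i)%MM : 'X_{1..3}.
pose lam (h : {mpoly K[3]}) : 'rV[K]_3 := \row_i h@_(m i).
have If : toric_ideal K A f.
  by rewrite Ifg; exists [:: (1, f)]; rewrite ?big_seq1 ?mul1r // => q;
    rewrite inE => /eqP ->; left.
have Ig : toric_ideal K A g.
  by rewrite Ifg; exists [:: (1, g)]; rewrite ?big_seq1 ?mul1r // => q;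
    rewrite inE => /eqP ->; right.
pose lam_fg := \matrix_(i < 2) (if i == ord0 then lam f else lam g).
have lam_span h : toric_ideal K A h ->
    exists x : 'rV[K]_2, lam h = x *m lam_fg.
  rewrite Ifg => -[s Ss ->]; elim: s Ss => [|q s IH] Ss.
    by exists 0; rewrite big_nil mul0mx; apply/rowP=> i; rewrite !mxE mcoeff0.
  have [|x ex] := IH; first by move=> p ps; apply: Ss; rewrite inE ps orbT.
  have [b eb] : exists b : 'I_2, q.2 = if b == ord0 then f else g.
    by case: (Ss q (mem_head _ _)) => ->; [exists ord0|exists ord_max].
  exists (x + q.1@_0%MM *: delta_mx 0 b).
  rewrite mulmxDl -ex -scalemxAl -rowE rowK.
  have -> : (if b == ord0 then lam f else lam g) = lam q.2 by rewrite eb;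
    case: eqP.
  apply/rowP=> i; rewrite big_cons !mxE mcoeffD addrC; congr (_ + _).
  by rewrite (coef_power_mul A_gt0 _ (minc i)) // eb; case: eqP.
have [u mu] : exists u : 'I_3 -> 'X_{1..3},
    forall i, u i i = 0%N /\ weight A (u i) = weight A (m i).
  have [|u mu] := @boolp.choice _ _ (fun i (v : 'X_{1..3}) =>
      v i = 0%N /\ weight A v = weight A (m i)).
    move=> i; have [[_ [v v0 wv]] _] := minc i.
    by exists v; rewrite /m weight_power.
  by exists u.
have c_gt0 i : (0 < c i)%N by have [[]] := minc i.
have lamE i : lam ('X_[m i] - 'X_[u i]) = delta_mx 0 i.
  apply/rowP=> j; rewrite !mxE mcoeffB !mcoeffX eqxx /=.
  have -> : (u i == m j) = false.
    apply/eqP => e; have [u0 wu] := mu i.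
    have [ij|ij] := eqVneq i j.
      by move: u0; rewrite e -ij /m mulmnE mnm1E eqxx mul1n; have := c_gt0 i;
        lia.
    apply: none; exists i, j, (c i); split=> //.
    by exists (c j); rewrite -!weight_power -/(m i) -/(m j) -e.
  suff -> : (m i == m j) = (j == i) by rewrite subr0.
  apply/eqP/eqP => [e|->//]; apply/eqP; apply: contraTT (c_gt0 i) => ji.
  have /mnmP/(_ i) := e.
  by rewrite /m !mulmnE !mnm1E eqxx mul1n (negPf ji) mul0n => ->.
have [x ex] := boolp.choice
  (fun i => lam_span _ (toric_binomial K (esym (mu i).2))).
have one : 1%:M = (\matrix_i x i) *m lam_fg.
  by apply/row_matrixP=> i; rewrite row_mul rowK -ex lamE row1.
suff : (\rank (1%:M : 'M[K]_3) <= 2)%N by rewrite mxrank1.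
by rewrite one; apply: leq_trans (mxrankM_maxr _ _) (rank_leq_row _).
Qed.

Lemma complete_intersection_glued : complete_intersection3 K A ->
  exists i1 i2 i3, uniq [:: i1; i2; i3] /\ glued A i1 i2 i3.
Proof.
case/complete_intersection_equal_multiples=> i [j [ci []]].
move=> ij [[ci0 _] minc] [cj eij].
have [k uk] : exists k, uniq [:: i; j; k].
  case: (pickP [pred k | (k != i) && (k != j)]) => [k /andP[ki kj]|none].
    by exists k; rewrite /= !inE negb_or ij eq_sym ki eq_sym kj.
  have /subset_leq_card : [set: 'I_3]%SET \subset [set i; j]%SET.
    by apply/fintype.subsetP=> k _; have := none k; rewrite !inE;
      case: eqP => //= _; case: eqP.
  by rewrite cardsT card_ord cards2 ij.
exists i, j, k; split=> //; rewrite /glued.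
set ni := A 0 i in eij *; set nj := A 0 j in eij *; set nk := A 0 k;
  set d := gcdn ni nj.
have ni0 : (0 < ni)%N := A_gt0 i; have nj0 : (0 < nj)%N := A_gt0 j.
have d_gt0 : (0 < d)%N by rewrite gcdn_gt0 ni0.
have [mi emi] : exists mi, ni = (mi * d)%N by apply/dvdnP/dvdn_gcdl.
have [mj emj] : exists mj, nj = (mj * d)%N by apply/dvdnP/dvdn_gcdr.
have mi0 : (0 < mi)%N by move: ni0; rewrite emi muln_gt0 => /andP[].
have mj0 : (0 < mj)%N by move: nj0; rewrite emj muln_gt0 => /andP[].
have cop : coprime mi mj.
  have : (gcdn mi mj * d = 1 * d)%N by rewrite muln_gcdl -emi -emj mul1n.
  by move/eqP; rewrite eqn_pmul2r.
have [x [y exy]] : exists x y, (x * mi = y * mj + 1)%N.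
  have [x y e _] := egcdnP mj mi0; exists x, y.
  by rewrite e (eqP cop).
pose a := ((nk * x) %% mj)%N; pose q := ((nk * x) %/ mj)%N.
have a_lt : (a < mj)%N by rewrite ltn_mod.
have ea : (a * mi + q * mj * mi = nk * y * mj + nk)%N.
  rewrite -mulnDl addnC -divn_eq -!mulnA exy; ring.
(* By Bezout nk = a mi + t mj with 0 <= a < mj.  A negative t would make
   a ni = d nk - t nj a multiple below the least one, since mj divides ci. *)
have [le_nk|lt_nk] := leqP (a * mi) nk.
  have le : (nk * y <= q * mi)%N.
    by rewrite -(leq_pmul2r mj0) -(leq_add2r nk); lia.
  exists a, (q * mi - nk * y)%N.
  rewrite emi emj mulnBl; have : (nk * y * (mj * d) <= q * mi * (mj * d))%N
    by rewrite leq_mul2r le orbT.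
  have : (d * (a * mi + q * mj * mi) = d * (nk * y * mj + nk))%N by rewrite ea.
  lia.
have lt : (q * mi < nk * y)%N.
  by rewrite -(ltn_pmul2r mj0) -(ltn_add2r nk); lia.
have : pure_multiple A i a.
  have [/= ik jk] : (i != k) /\ (j != k) by move: uk;
    rewrite /= !inE negb_or => /andP[/andP[_ ->] /andP[->]].
  split; first by move: lt_nk; rewrite /nk; have := A_gt0 k; case: (a).
  exists (U_(k) *+ d + U_(j) *+ (nk * y - q * mi))%MM.
    by rewrite mnmDE !mulmnE !mnm1E !(eq_sym _ i) (negPf ik) (negPf ij).
  rewrite weightD !weight_power -/nj -/nk -/ni emi emj mulnBl.
  have : (q * mi * (mj * d) <= nk * y * (mj * d))%N
    by rewrite leq_mul2r (ltnW lt) orbT.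
  have : (d * (a * mi + q * mj * mi) = d * (nk * y * mj + nk))%N by rewrite ea.
  lia.
move=> /minc le_ci.
have : (mj %| ci * mi)%N.
  apply/dvdnP; exists cj; apply/eqP; rewrite -(eqn_pmul2r d_gt0).
  by rewrite -!mulnA -emi -emj eij.
rewrite mulnC Gauss_dvdr 1?coprime_sym // => /(dvdn_leq ci0) le_mj.
by have := leq_trans le_mj le_ci; rewrite leqNgt a_lt.
Qed.

End CompleteIntersection.

(** * Numerical semigroups with three generators *)

Local Open Scope classical_set_scope.
Local Open Scope nat_scope.
Local Open Scope card_scope.

Theorem theorem3p4 (K : fieldType) (n1 n2 n3 : nat)
    (n1_gt0 : 0 < n1) (n2_gt0 : 0 < n2) (n3_gt0 : 0 < n3)
    (distinct : uniq [:: n1; n2; n3])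
    (gcd1 : gcdn n1 (gcdn n2 n3) = 1)
    (ciA : complete_intersection3 K (row3 n1 n2 n3)) :
  is_markov_complexity (row3 n1 n2 n3) 2 /\
  exists k : nat, graver_basis (row3 n1 n2 n3) #= `I_k /\
    forall r : nat, 2 <= r ->
      universal_markov_basis (lawrence r (row3 n1 n2 n3))
        = indispensable (lawrence r (row3 n1 n2 n3)) /\
      universal_markov_basis (lawrence r (row3 n1 n2 n3))
        #= `I_(k * 'C(r, 2)).
Proof.
set A := row3 n1 n2 n3.
have A_gt0 (c : 'I_3) : 0 < A 0%R c.
  by rewrite /A mxE; case: c => [[|[|[|//]]] ?].
have [i1 [i2 [i3 [uniqi gl]]]] := complete_intersection_glued A_gt0 ciA.
have gcd_i : gcdn (gcdn (A 0%R i1) (A 0%R i2)) (A 0%R i3) = 1.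
  have dvd_A c : gcdn (gcdn (A 0%R i1) (A 0%R i2)) (A 0%R i3) %| A 0%R c.
    case: (ord3_cases uniqi c) => ->; last exact: dvdn_gcdr.
      exact: dvdn_trans (dvdn_gcdl _ _) (dvdn_gcdl _ _).
    exact: dvdn_trans (dvdn_gcdl _ _) (dvdn_gcdr _ _).
  have g1 := dvd_A ord0; have g2 := dvd_A (inord 1); have g3 := dvd_A ord_max.
  rewrite /A [in X in _ %| X]mxE /= in g1.
  rewrite /A [in X in _ %| X]mxE /= inordK // in g2.
  rewrite /A [in X in _ %| X]mxE /= in g3.
  by apply/eqP; rewrite -dvdn1 -[X in _ %| X]gcd1 !dvdn_gcd g1 g2 g3.
have redA := glued_distance_reducing A_gt0 gcd_i uniqi gl.
have [k cardG] : exists k, graver_basis A #= `I_k.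
  by apply/finite_setP/finite_image/graver_row_finite.
have ne01 : ord0 != ord_max :> 'I_3 by [].
have [mc card_r] := lawrence_universal_markov (pointed_row A_gt0) redA cardG
  (ex_intro2 _ _ _ (exchange_lattice A ne01) (exchange_neq0 A_gt0 _ _)).
by split=> //; exists k.
Qed.
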